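(* Let $1<p,q<\infty$ with $\frac1p+\frac1q<1$ and $p>2$, and let $f(z)=\sum_{k\ge0}a_kz^k\in AT^q_p$. Let $\mu$ be a finite positive Borel measure on $[0,1)$ with moments $\mu_n=\int_0^1t^n\,d\mu(t)$, $n=0,1,2,\dots$. If $\mu$ is a $1$-CM on $[0,1)$, then: (i) for each $n\in\mathbb N$, $\displaystyle\sum_{k\ge0}\mu_{n+k}|a_k|<\infty$; (ii) the power series $$\mathcal H_\mu(f)(z)=\sum_{n=0}^\infty\left(\sum_{k=0}^\infty\mu_{n+k}a_k\right)z^n,\qquad z\in\mathbb D,$$ represents an analytic function in $\mathbb D$; (iii) $\displaystyle\mathcal H_\mu(f)(z)=\mathcal I_\mu(f)(z)=\int_0^1\frac{f(t)}{1-tz}\,d\mu(t)$ for all $z\in\mathbb D$.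
   Context: $\mathbb D$ is the open unit disc of $\mathbb C$, $\mathbb T$ the unit circle, $dA$ the normalized area Lebesgue measure on $\mathbb D$, $|d\xi|$ arc length on $\mathbb T$. For $\xi\in\mathbb T$ put $$\Gamma_{1/2}(\xi)=\{z\in\mathbb D:|z|<1/2\}\cup\bigcup_{|z|<1/2}[z,\xi),$$ where $[z,\xi)$ is the half-open line segment from $z$ to $\xi$. For $1<p,q<\infty$, $AT^q_p$ is the space of analytic functions $f$ on $\mathbb D$ such that $$\|f\|_{AT^q_p}=\left\{\int_{\mathbb T}\left(\int_{\Gamma_{1/2}(\xi)}|f(z)|^p\,\frac{dA(z)}{1-|z|^2}\right)^{q/p}|d\xi|\right\}^{1/q}<\infty.$$ A finite positive Borel measure $\mu$ on $[0,1)$ is a $1$-Carleson measure ($1$-CM) if $\sup_{t\in[0,1)}\frac{\mu([t,1))}{1-t}<\infty$. *)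

(* Defs.v *)
From HB Require Import structures.
From mathcomp Require Import all_boot all_order all_algebra.
From mathcomp Require Import complex.
From mathcomp Require Import all_classical all_reals all_analysis.

Set Implicit Arguments.
Unset Strict Implicit.
Unset Printing Implicit Defensive.

Import Order.TTheory GRing.Theory Num.Theory.
Import numFieldNormedType.Exports.

Local Open Scope classical_set_scope.
Local Open Scope complex_scope.
Local Open Scope ring_scope.

(* R[i] carries its topology and its structure of normed module over itself
   through the alias R[i]^o. The R[i]-valued norm `|z| of the library is
   (cmod z)%:C. *)
Notation cmod := ComplexField.Normc.normc.

Definition unit_disc (R : realType) : set R[i]^o := [set z | cmod z < 1].

(* derivable over the scalar field R[i], i.e. complex differentiability. *)
Definition analytic_on_disc (R : realType) (f : R[i]^o -> R[i]^o) : Prop :=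
  forall z : R[i]^o, unit_disc z -> derivable f z 1.

Definition half_open_segment (R : realType) (z xi : R[i]^o) : set R[i]^o :=
  [set w | exists2 s : R, 0 <= s < 1 & w = (1 - s)%:C * z + s%:C * xi].

Definition Gamma_half (R : realType) (xi : R[i]^o) : set R[i]^o :=
  [set z | unit_disc z /\ cmod z < 2^-1] `|`
  \bigcup_(z in [set z : R[i]^o | cmod z < 2^-1]) half_open_segment z xi.

Section area_and_arc_length.
Local Open Scope ereal_scope.

(* The normalized area of the unit disc is 1, whence the factor 1/pi. *)
Definition area_integral (R : realType) (A : set R[i]^o) (g : R[i]^o -> R)
    : \bar R :=
  (pi^-1)%:E *
  \int[@lebesgue_measure R \x @lebesgue_measure R]_(w in
     [set w | A (w.1 +i* w.2)%C]) (g (w.1 +i* w.2)%C)%:E.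

Definition circle_integral (R : realType) (g : R[i]^o -> \bar R) : \bar R :=
  \int[@lebesgue_measure R]_(theta in `[0%R, (2 * pi)%R])
    g (cos theta +i* sin theta)%C.

Definition AT_norm (R : realType) (p q : R) (f : R[i]^o -> R[i]^o) : \bar R :=
  (circle_integral (fun xi =>
     (area_integral (Gamma_half xi)
        (fun z => (cmod (f z) `^ p / (1 - cmod z ^+ 2))%R)) `^ (q / p)%R))
  `^ (q^-1)%R.

Definition AT_space (R : realType) (p q : R) : set (R[i]^o -> R[i]^o) :=
  [set f | analytic_on_disc f /\ AT_norm p q f < +oo].

End area_and_arc_length.

(* Borel measures on [0, 1) are given by Borel measures mu on R, of which only
   the restriction to `[0, 1[ is ever used. *)

Definition moment (R : realType) (mu : {finite_measure set R -> \bar R})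
    (n : nat) : R :=
  \int[mu]_(t in `[0, 1[) (t ^+ n).

Definition one_Carleson (R : realType) (mu : {finite_measure set R -> \bar R})
    : Prop :=
  (ereal_sup [set mu [set` `[t, 1%R[] * ((1 - t)^-1)%R%:E | t in `[0%R, 1%R[]
   < +oo)%E.

Definition cintegrable (R : realType) (mu : {finite_measure set R -> \bar R})
    (g : R -> R[i]^o) : Prop :=
  mu.-integrable `[0, 1[ (fun t => (complex.Re (g t))%:E) /\
  mu.-integrable `[0, 1[ (fun t => (complex.Im (g t))%:E).

Definition cintegral (R : realType) (mu : {finite_measure set R -> \bar R})
    (g : R -> R[i]^o) : R[i]^o :=
  (\int[mu]_(t in `[0, 1[) complex.Re (g t)) +i*
  (\int[mu]_(t in `[0, 1[) complex.Im (g t)).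

Definition Imu_integrand (R : realType) (f : R[i]^o -> R[i]^o) (z : R[i]^o)
    (t : R) : R[i]^o :=
  f t%:C / (1 - t%:C * z).

Definition Imu (R : realType) (mu : {finite_measure set R -> \bar R})
    (f : R[i]^o -> R[i]^o) (z : R[i]^o) : R[i]^o :=
  cintegral mu (Imu_integrand f z).

(* H_mu is expressed through the Taylor coefficients a of f at the origin. *)
Definition Hmu_coef_series (R : realType)
    (mu : {finite_measure set R -> \bar R}) (a : nat -> R[i]^o) (n : nat)
    : nat -> R[i]^o :=
  series (fun k => (moment mu (n + k))%:C * a k : R[i]^o).

Definition Hmu_coef (R : realType) (mu : {finite_measure set R -> \bar R})
    (a : nat -> R[i]^o) (n : nat) : R[i]^o :=
  limn (Hmu_coef_series mu a n).

Definition Hmu_series (R : realType) (mu : {finite_measure set R -> \bar R})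
    (a : nat -> R[i]^o) (z : R[i]^o) : nat -> R[i]^o :=
  series (fun n => Hmu_coef mu a n * z ^+ n : R[i]^o).

Definition Hmu (R : realType) (mu : {finite_measure set R -> \bar R})
    (a : nat -> R[i]^o) (z : R[i]^o) : R[i]^o :=
  limn (Hmu_series mu a z).

(* Main.v *)
Require Import Defs.
From HB Require Import structures.
From mathcomp Require Import all_boot all_order all_algebra.
From mathcomp Require Import complex.
From mathcomp Require Import all_classical all_reals all_analysis.
From mathcomp Require Import measurable_realfun ring lra.

Set Implicit Arguments.
Unset Strict Implicit.
Unset Printing Implicit Defensive.

Import Order.TTheory GRing.Theory Num.Theory.
Import numFieldNormedType.Exports.

Local Open Scope classical_set_scope.
Local Open Scope complex_scope.
Local Open Scope ring_scope.

(* Write A(xi) for the inner area integral over Gamma_half xi and d = 1 - r. A disc of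
   radius d / 4 around r e^(i phi) lies in Gamma_half (e^(i theta)) when |phi - theta| <= d / 8,
   so submeanness of |f| ^ p gives d |f (r e^(i phi))| ^ p <= C A(e^(i theta)). Raising this to
   the power q / p and integrating in theta bounds the integral of |f| ^ q over the circle of
   radius r by C d ^ (- q / p) and the supremum of |f| by C d ^ (- 1 / p - 1 / q).
   Interpolating, the integral of |f| ^ 2 is at most C d ^ (- g) for some g < 1 (g = 2 / p if q > 2, and
   g = 2 / p + 2 / q - 1 otherwise). Parseval and Cauchy-Schwarz then give
   \sum_k |a_k| t ^ k <= C (1 - t) ^ (- (1 + g) / 2), which is mu-integrable because mu is
   1-Carleson and (1 + g) / 2 < 1. Everything else is dominated convergence.

   Both the mean value property and Parseval are obtained by averaging over roots of
   unity; the former then only needs the rotation invariance of planar Lebesgue measure,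
   a rotation being a product of three shears. *)

(** Absolute values of coefficients force the detour through squares: a bound for |f(t)| controls
    the integral of f against [mu], but not the sum of |a_k| t^k, where no cancellation is left,
    whereas square means on circles depend on the |a_k| only. Passing from squares to first powers
    costs (1 - t)^(-1/2), because the geometric weights sum to 1 / (1 - t); the exponent (1 + g) / 2
    must stay below 1, since (1 - t)^(-1) already fails for Lebesgue measure, which is 1-Carleson.
    Hence g < 1 is the target, and the conditions on the exponents enter exactly there: p > 2 gives
    2/p < 1, and 1/p + 1/q < 1 gives 2/p + 2/q - 1 < 1.

    All information on f is read off the partial sums of its power series. Averages over M-th roots
    of unity are exact for polynomials of degree below M, and partial sums approximate f uniformly
    on smaller discs, so M can be chosen independently of the point on a circle. The approximation
    error is then absorbed into constants, none of which is optimised. *)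

(* Monotonicity without measurability: the tent regions and the area function
   need not be shown measurable. *)
Lemma ge0_subset_le_integral d (T : measurableType d) (R : realType)
    (mu : {measure set T -> \bar R}) (D E : set T) (f g : T -> \bar R) :
  D `<=` E -> (forall x, D x -> 0 <= f x <= g x)%E ->
  (forall x, E x -> 0 <= g x)%E ->
  (\int[mu]_(x in D) f x <= \int[mu]_(x in E) g x)%E.
Proof.
move=> DE fg g0.
rewrite !ge0_integralE//; last by move=> x /fg /andP[].
apply: le_ereal_sup => _ /= [h hf <-]; exists h => // x.
apply: (le_trans (hf x)); rewrite /patch.
case: ifPn => [/set_mem Dx|]; last first.
  by move=> _; case: ifPn => // /set_mem /g0.
by rewrite mem_set; [case/andP: (fg _ Dx) | exact: DE].
Qed.

(** * Planar Lebesgue measure *)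

Section plane_measure.
Variable R : realType.
Local Notation L := (@lebesgue_measure R).
Local Notation L2 := (@lebesgue_measure R \x @lebesgue_measure R)%E.
Local Notation plane := (measurableTypeR R * measurableTypeR R)%type.

(** The translated Lebesgue measure agrees with Lebesgue measure on the intervals ]a, b], and this
    determines it. *)
Lemma ge0_integral_shift (g : measurableTypeR R -> \bar R) (c : R) :
  measurable_fun setT g -> (forall x, 0 <= g x)%E ->
  (\int[L]_x g (x + c)%R = \int[L]_x g x)%E.
Proof.
move=> mg g0.
have mc : measurable_fun [set: measurableTypeR R]
    (fun x : measurableTypeR R => x + c : measurableTypeR R).
  exact: measurable_funD.
have := @ge0_integral_pushforward _ _ (measurableTypeR R) (measurableTypeR R) R
  (fun x => x + c) mc L setT g measurableT mg (fun x _ => g0 x).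
rewrite preimage_setT => <-.
apply: eq_measure_integral => A mA _.
apply/esym/lebesgue_measure_unique => //= _ [[a b]] _ <-.
rewrite /pushforward /=.
have -> : (fun x : R => x + c) @^-1` `]a, b] = `]a - c, b - c]%classic.
  by apply/seteqP; split => x /=; rewrite !in_itv /= ltrBlDr lerBrDr.
rewrite !lebesgue_measure_itv /= !lte_fin ltrD2r.
by case: ifP => // _; rewrite -!EFinD; congr (_%:E); lra.
Qed.

(** Phrased through integrals of nonnegative measurable functions, not measures of sets, so that it
    comes straight out of Tonelli and is stable under composition. *)
Definition plane_invariant (phi : plane -> plane) : Prop :=
  measurable_fun setT phi /\
  forall g : plane -> \bar R, measurable_fun setT g -> (forall w, 0 <= g w)%E ->
    (\int[L2]_w g (phi w) = \int[L2]_w g w)%E.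

Lemma plane_invariant_comp phi psi :
  plane_invariant phi -> plane_invariant psi -> plane_invariant (phi \o psi).
Proof.
move=> [mphi iphi] [mpsi ipsi]; split; first exact: measurableT_comp.
move=> g mg g0 /=; have := ipsi (g \o phi); rewrite iphi// => -> //.
  exact: measurableT_comp.
by move=> w; exact: g0.
Qed.

(** At a fixed ordinate the shear is a translation of the abscissa; Tonelli with the abscissa
    innermost reduces the claim to [ge0_integral_shift]. *)
Lemma plane_invariant_hshear (h : measurableTypeR R -> measurableTypeR R) :
  measurable_fun setT h ->
  plane_invariant (fun w => (w.1 + h w.2, w.2)).
Proof.
move=> mh.
have mphi : measurable_fun setT (fun w : plane => (w.1 + h w.2, w.2) : plane).
  apply: measurable_fun_pair => //=.
  by apply: measurable_funD => //; exact: measurableT_comp.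
split => // g mg g0.
rewrite !fubini_tonelli2//; last exact: measurableT_comp.
rewrite /fubini_G; apply: eq_integral => y _ /=.
apply: (@ge0_integral_shift (fun x => g (x, y))) => //.
by apply: measurableT_comp => //; exact: measurable_fun_pair.
Qed.

Lemma plane_invariant_vshear (h : measurableTypeR R -> measurableTypeR R) :
  measurable_fun setT h ->
  plane_invariant (fun w => (w.1, w.2 + h w.1)).
Proof.
move=> mh.
have mphi : measurable_fun setT (fun w : plane => (w.1, w.2 + h w.1) : plane).
  apply: measurable_fun_pair => //=.
  by apply: measurable_funD => //; exact: measurableT_comp.
split => // g mg g0.
rewrite !fubini_tonelli1//; last exact: measurableT_comp.
rewrite /fubini_F; apply: eq_integral => x _ /=.
apply: (@ge0_integral_shift (fun y => g (x, y))) => //.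
by apply: measurableT_comp => //; exact: measurable_fun_pair.
Qed.

Lemma plane_invariant_translation (a b : R) :
  plane_invariant (fun w => (w.1 + a, w.2 + b)).
Proof.
exact: (plane_invariant_comp (plane_invariant_hshear (measurable_cst a))
  (plane_invariant_vshear (measurable_cst b))).
Qed.

(* A rotation by an angle which is not a multiple of pi is a product of three
   shears; the rotation by pi is the square of the one by pi / 2. *)
Lemma plane_invariant_rotation (a b : R) : a ^+ 2 + b ^+ 2 = 1 ->
  plane_invariant (fun w => (a * w.1 - b * w.2, b * w.1 + a * w.2)).
Proof.
have main c s : c ^+ 2 + s ^+ 2 = 1 -> s != 0 ->
    plane_invariant (fun w => (c * w.1 - s * w.2, s * w.1 + c * w.2)).
  move=> cs s0.
  have mM k : measurable_fun setT (fun x : measurableTypeR R => k * x).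
    exact: measurable_funM.
  (* For the rotation by theta this slope is - tan (theta / 2); it serves for the two outer shears,
     and sin theta for the middle one. *)
  pose t := (c - 1) / s.
  have H := plane_invariant_hshear (mM t).
  have V := plane_invariant_vshear (mM s).
  have := plane_invariant_comp H (plane_invariant_comp V H).
  congr plane_invariant; apply/funext => -[x y] /=.
  have cE : c = 1 + t * s by rewrite /t divfK// addrC subrK.
  have sE : s = - (t * (c + 1)).
    rewrite /t mulrAC -subr_sqr expr1n.
    have -> : c ^+ 2 - 1 = - s ^+ 2 by lra.
    by rewrite mulNr opprK expr2 mulfK.
  have tE : t + t * (1 + t * s) = - s by rewrite -cE [in RHS]sE opprK; ring.
  congr pair; last by rewrite cE; ring.
  by rewrite -mulNr -tE cE; ring.
move=> ab; have [b0|b0] := eqVneq b 0; last exact: main.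
have : (a - 1) * (a + 1) = 0 by rewrite -subr_sqr expr1n -ab b0; ring.
move=> /eqP; rewrite mulf_eq0 => /orP[|] /eqP a1.
  have -> : (fun w => (a * w.1 - b * w.2, b * w.1 + a * w.2)) = (fun w : plane => w).
    apply/funext => -[x y] /=; have -> : a = 1 by lra.
    by rewrite b0; congr pair; ring.
  by split.
have H : plane_invariant (fun w => (0 * w.1 - 1 * w.2, 1 * w.1 + 0 * w.2)).
  by apply: main; rewrite ?oner_neq0//; ring.
have := plane_invariant_comp H H.
congr plane_invariant; apply/funext => -[x y] /=.
have -> : a = -1 by lra.
by rewrite b0; congr pair; ring.
Qed.

End plane_measure.

(** * Complex numbers and roots of unity *)

Section complex_modulus.
Variable R : realType.
Implicit Types z w : R[i].

Lemma normcE_cmod (z : R[i]^o) : `|z| = (cmod z)%:C.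
Proof. by []. Qed.

Lemma cmod_ge0 z : 0 <= cmod z.
Proof. by case: z => x y /=; exact: sqrtr_ge0. Qed.

Lemma cmodM z w : cmod (z * w) = cmod z * cmod w.
Proof. exact: ComplexField.Normc.normcM. Qed.

Lemma cmod0 : cmod (0 : R[i]) = 0.
Proof. exact: ComplexField.Normc.normc0. Qed.

Lemma cmod1 : cmod (1 : R[i]) = 1.
Proof. exact: ComplexField.Normc.normc1. Qed.

Lemma cmodV z : cmod z^-1 = (cmod z)^-1.
Proof. exact: ComplexField.Normc.normcV. Qed.

Lemma cmodN z : cmod (- z) = cmod z.
Proof. exact: normcN. Qed.

Lemma cmodB z w : cmod (z - w) = cmod (w - z).
Proof. by rewrite -cmodN opprB. Qed.

Lemma cmodX z n : cmod (z ^+ n) = cmod z ^+ n.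
Proof. by elim: n => [|n IH]; rewrite ?expr0 ?cmod1// !exprS cmodM IH. Qed.

Lemma cmod_real (x : R) : cmod x%:C = `|x|.
Proof. by rewrite /= expr0n addr0 sqrtr_sqr. Qed.

Lemma cmod_nat n : cmod (n%:R : R[i]) = n%:R.
Proof.
have -> : (n%:R : R[i]) = (n%:R : R)%:C by rewrite rmorph_nat.
by rewrite cmod_real ger0_norm.
Qed.

Lemma cmod_sqr z : cmod z ^+ 2 = complex.Re z ^+ 2 + complex.Im z ^+ 2.
Proof. by case: z => x y /=; rewrite sqr_sqrtr// addr_ge0// sqr_ge0. Qed.

Lemma cmod_eq0 z : (cmod z == 0) = (z == 0).
Proof.
by apply/eqP/eqP => [/ComplexField.Normc.eq0_normc|->]; rewrite ?cmod0.
Qed.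

Lemma le_cmodD z w : cmod (z + w) <= cmod z + cmod w.
Proof. exact: le_normcD. Qed.

Lemma le_cmodB z w : cmod z - cmod w <= cmod (z - w).
Proof. by rewrite lerBlDr -{1}(subrK w z) le_cmodD. Qed.

Lemma le_cmod_sum (I : Type) (s : seq I) (P : pred I) (F : I -> R[i]) :
  cmod (\sum_(i <- s | P i) F i) <= \sum_(i <- s | P i) cmod (F i).
Proof.
elim/big_rec2 : _ => [|i x y _ xy]; first by rewrite cmod0.
by apply: (le_trans (le_cmodD _ _)); rewrite lerD2l.
Qed.

Lemma ReD z w : complex.Re (z + w) = complex.Re z + complex.Re w.
Proof. by case: z; case: w. Qed.

Lemma ImD z w : complex.Im (z + w) = complex.Im z + complex.Im w.
Proof. by case: z; case: w. Qed.

Lemma ReB z w : complex.Re (z - w) = complex.Re z - complex.Re w.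
Proof. by case: z; case: w. Qed.

Lemma ImB z w : complex.Im (z - w) = complex.Im z - complex.Im w.
Proof. by case: z; case: w. Qed.

Lemma ReM z w :
  complex.Re (z * w) = complex.Re z * complex.Re w - complex.Im z * complex.Im w.
Proof. by case: z; case: w. Qed.

Lemma ImM z w :
  complex.Im (z * w) = complex.Re z * complex.Im w + complex.Im z * complex.Re w.
Proof. by case: z; case: w. Qed.

Lemma le_Re_cmod z : `|complex.Re z| <= cmod z.
Proof.
rewrite -(@ler_pXn2r _ 2)// ?nnegrE ?cmod_ge0//.
by rewrite cmod_sqr real_normK ?num_real// lerDl sqr_ge0.
Qed.

Lemma le_Im_cmod z : `|complex.Im z| <= cmod z.
Proof.
rewrite -(@ler_pXn2r _ 2)// ?nnegrE ?cmod_ge0//.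
by rewrite cmod_sqr real_normK ?num_real// lerDr sqr_ge0.
Qed.

Lemma cmod_le_ReIm z : cmod z <= `|complex.Re z| + `|complex.Im z|.
Proof.
rewrite -(@ler_pXn2r _ 2)// ?nnegrE ?cmod_ge0// ?addr_ge0//.
rewrite cmod_sqr sqrrD !real_normK ?num_real// -addrA lerD2l lerDr.
by rewrite mulrn_wge0// mulr_ge0.
Qed.

(** The norm of [R[i]^o] takes values in [R[i]], whose positive elements are the positive reals.
    This equivalence moves every complex limit to a real one. *)
Lemma ccvgP (T : Type) (F : set_system T) {FF : Filter F} (u : T -> R[i]^o)
    (l : R[i]^o) :
  u @ F --> l <-> (fun t => cmod (u t - l)) @ F --> (0 : R).
Proof.
split=> [/cvgrPdist_lt ul|/cvgrPdist_lt ul].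
  apply/cvgrPdist_lt => e e0.
  have e0' : 0 < e%:C :> R[i] by rewrite (ltcR 0).
  apply: filterS (ul _ e0') => t; rewrite normcE_cmod ltcR => ut.
  by rewrite sub0r normrN ger0_norm ?cmod_ge0// cmodB.
apply/cvgrPdist_lt => -[e e']; rewrite ltcE /= => /andP[/eqP -> e0].
apply: filterS (ul _ e0) => t; rewrite sub0r normrN ger0_norm ?cmod_ge0// => ut.
by rewrite normcE_cmod cmodB (ltcR _ e).
Qed.

End complex_modulus.

(** * Roots of unity: exact averages of polynomials and discrete Parseval *)

Section roots_of_unity.
Variable R : realType.
Local Notation C := R[i].

Definition cis (x : R) : C := cos x +i* sin x.

Lemma cisD x y : cis (x + y) = cis x * cis y.
Proof.
rewrite /cis cosD sinD; apply/eqP; rewrite eq_complex /=.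
by apply/andP; split; apply/eqP => //; rewrite addrC mulrC [X in _ + X]mulrC.
Qed.

Lemma cis0 : cis 0 = 1.
Proof. by rewrite /cis cos0 sin0. Qed.

Lemma cis2pi : cis (2 * pi) = 1.
Proof. by rewrite mulr_natl -[pi *+ 2]add0r /cis cosD2pi sinD2pi cos0 sin0. Qed.

Lemma cisX x n : cis x ^+ n = cis (x *+ n).
Proof.
by elim: n => [|n IH]; rewrite ?expr0 ?mulr0n ?cis0// exprS IH mulrS cisD.
Qed.

Lemma cmod_cis x : cmod (cis x) = 1.
Proof. by rewrite /= cos2Dsin2 sqrtr1. Qed.

(** By the half-angle formula cos x = 1 - 2 sin^2 (x/2), and sin (x/2) > 0 on this range. *)
Lemma cis_neq1 x : 0 < x < 2 * pi -> cis x != 1.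
Proof.
move=> /andP[x0 x2pi]; apply/eqP => -[cx _].
have : 0 < sin (x / 2) by apply: sin_gt0_pi; lra.
have : cos x = 1 - 2 * sin (x / 2) ^+ 2.
  by rewrite {1}(splitr x) -mulr2n cosD -!expr2 cos2sin2; lra.
rewrite cx => /eqP; rewrite -subr_eq0 opprB addrC subrK mulf_eq0.
by rewrite pnatr_eq0/= expf_eq0/= => /eqP ->; rewrite ltxx.
Qed.

Definition rootu (M : nat) : C := cis (2 * pi / M%:R).

Lemma cmod_rootu M : cmod (rootu M) = 1.
Proof. exact: cmod_cis. Qed.

Lemma rootu_prim M : (0 < M)%N -> M.-primitive_root (rootu M).
Proof.
move=> M0; apply/andP; split => //; apply/forallP => -[i iM] /=.
rewrite unity_rootE /rootu cisX -[_ *+ i.+1]mulr_natr.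
have M0' : 0 < M%:R :> R by rewrite ltr0n.
have [<-|iM'] := eqVneq i.+1 M.
  by rewrite divfK ?pnatr_eq0// cis2pi !eqxx.
have {}iM : (i.+1 < M)%N by rewrite ltn_neqAle iM'.
rewrite (negbTE (cis_neq1 _))//; apply/andP; split.
  by rewrite mulr_gt0// ?ltr0n// divr_gt0// mulr_gt0// pi_gt0.
rewrite -mulrA gtr_pMr ?mulr_gt0// ?pi_gt0//.
by rewrite mulrC ltr_pdivrMr// mul1r ltr_nat.
Qed.

Lemma sum_geometric_unity (M : nat) (eta : C) : eta ^+ M = 1 -> eta != 1 ->
  \sum_(j < M) eta ^+ j = 0.
Proof.
move=> eM e1; apply: (mulfI (_ : eta - 1 != 0)); first by rewrite subr_eq0.
by rewrite -subrX1 eM subrr mulr0.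
Qed.

(** Every monomial of degree strictly between 0 and M sums to zero over the M-th roots of unity.
    Degree M would be indistinguishable from a constant, whence the bound on the size. *)
Lemma sum_rootu_horner (M : nat) (q : {poly C}) (u : C) : (0 < M)%N ->
  (size q <= M)%N ->
  \sum_(j < M) q.[rootu M ^+ j * u] = M%:R * q`_0.
Proof.
move=> M0 qM; have wM := rootu_prim M0.
under eq_bigr do rewrite (horner_coef_wide _ qM).
rewrite exchange_big /=.
case: M M0 qM wM => // M _ qM wM.
rewrite big_ord_recl [X in _ + X]big1 ?addr0; last first.
  move=> k _.
  transitivity (\sum_(j < M.+1) q`_(lift ord0 k) * u ^+ lift ord0 k *
      (rootu M.+1 ^+ lift ord0 k) ^+ j).
    by apply: eq_bigr => j _; rewrite exprMn exprAC; ring.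
  rewrite -mulr_sumr sum_geometric_unity ?mulr0//.
    by rewrite -exprM mulnC exprM (prim_expr_order wM)// expr1n.
  rewrite -(prim_order_dvd wM) /lift /= /bump /= add1n.
  by rewrite gtnNdvd// ltnS.
rewrite (eq_bigr (fun=> q`_0)); last by move=> j _; rewrite expr0 mulr1.
by rewrite sumr_const card_ord mulr_natl.
Qed.

(** Orthogonality of the characters of Z/M, after writing squared moduli as products with
    conjugates; distinct k, l < M give distinct characters. *)
Lemma discrete_Parseval (M : nat) (a : nat -> C) (u : C) : (0 < M)%N ->
  \sum_(j < M) cmod (\sum_(k < M) a k * (rootu M ^+ j * u) ^+ k) ^+ 2 =
  M%:R * \sum_(k < M) cmod (a k) ^+ 2 * cmod u ^+ (k.*2).
Proof.
move=> M0; have wM := rootu_prim M0.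
have sqE (z : C) : (cmod z ^+ 2)%:C = z * z^*%C.
  by rewrite rmorphXn /= -sqr_normc.
apply: (@complexI R); rewrite rmorphM rmorph_nat !rmorph_sum /=.
transitivity (\sum_(j < M) \sum_(k < M) \sum_(l < M)
   (a k * u ^+ k * (a l * u ^+ l)^*%C) *
   (rootu M ^+ k * (rootu M ^+ l)^*%C) ^+ j).
  apply: eq_bigr => j _; rewrite sqE rmorph_sum /= big_distrl /=.
  apply: eq_bigr => k _; rewrite big_distrr /=; apply: eq_bigr => l _.
  by rewrite !(rmorphM, rmorphXn) /= !exprMn -!exprM ![(_ * j)%N]mulnC; ring.
rewrite exchange_big /= mulr_sumr; apply: eq_bigr => k _.
rewrite exchange_big /= (bigD1 k)//= [X in _ + X]big1 ?addr0; last first.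
  move=> l lk; rewrite -mulr_sumr sum_geometric_unity ?mulr0//.
    rewrite exprMn -rmorphXn /= -!exprM ![(_ * M)%N]mulnC !exprM.
    by rewrite (prim_expr_order wM) !expr1n mul1r rmorph1.
  have wl : rootu M ^+ l * (rootu M ^+ l)^*%C = 1.
    by rewrite -sqE cmodX cmod_rootu !expr1n.
  apply: contra lk => /eqP H.
  have : rootu M ^+ k = rootu M ^+ l.
    by rewrite -[LHS]mulr1 -wl mulrCA H mulr1.
  move=> /eqP; rewrite (eq_prim_root_expr wM) !modn_small//.
  by move=> /eqP/val_inj ->.
have wk : rootu M ^+ k * (rootu M ^+ k)^*%C = 1.
  by rewrite -sqE cmodX cmod_rootu !expr1n.
rewrite wk (eq_bigr (fun=> a k * u ^+ k * (a k * u ^+ k)^*%C)); last first.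
  by move=> j _; rewrite expr1n mulr1.
rewrite sumr_const card_ord mulr_natl -sqE cmodM cmodX exprMn -exprM.
by rewrite muln2.
Qed.

End roots_of_unity.

(** * Power series *)

Section complex_measurability.
Context d (T : measurableType d) (R : realType) (D : set T).
Implicit Types g h : T -> R[i].

(** Componentwise, to match [cintegrable] and [cintegral], which treat real and imaginary parts
    separately. *)
Definition cmeasurable g : Prop :=
  measurable_fun D (fun t => complex.Re (g t)) /\
  measurable_fun D (fun t => complex.Im (g t)).

Lemma cmeasurable_cst (c : R[i]) : cmeasurable (fun=> c).
Proof. by split; exact: measurable_cst. Qed.

Lemma cmeasurableD g h :
  cmeasurable g -> cmeasurable h -> cmeasurable (fun t => g t + h t).
Proof.
move=> [g1 g2] [h1 h2]; split.
  under eq_fun do rewrite ReD.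
  exact: measurable_funD.
under eq_fun do rewrite ImD.
exact: measurable_funD.
Qed.

Lemma cmeasurableM g h :
  cmeasurable g -> cmeasurable h -> cmeasurable (fun t => g t * h t).
Proof.
move=> [g1 g2] [h1 h2]; split.
  under eq_fun do rewrite ReM.
  by apply: measurable_funB; exact: measurable_funM.
under eq_fun do rewrite ImM.
by apply: measurable_funD; exact: measurable_funM.
Qed.

Lemma cmeasurableX g n : cmeasurable g -> cmeasurable (fun t => g t ^+ n).
Proof.
move=> mg; elim: n => [|n IH].
  under eq_fun do rewrite expr0.
  exact: cmeasurable_cst.
under eq_fun do rewrite exprS.
exact: cmeasurableM.
Qed.

Lemma cmeasurable_sum (G : nat -> T -> R[i]) m n :
  (forall k, cmeasurable (G k)) ->
  cmeasurable (fun t => \sum_(m <= k < n) G k t).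
Proof.
move=> mG; rewrite /index_iota; elim: (iota _ _) => [|k s IH].
  under eq_fun do rewrite big_nil.
  exact: cmeasurable_cst.
under eq_fun do rewrite big_cons.
exact: cmeasurableD.
Qed.

Lemma cmeasurable_real (x : T -> R) :
  measurable_fun D x -> cmeasurable (fun t => (x t)%:C).
Proof. by move=> mx; split => //; exact: measurable_cst. Qed.

Lemma measurable_cmod g : cmeasurable g -> measurable_fun D (fun t => cmod (g t)).
Proof.
move=> [g1 g2].
have -> : (fun t => cmod (g t)) =
    (fun t => (complex.Re (g t) ^+ 2 + complex.Im (g t) ^+ 2) `^ 2^-1).
  apply/funext => t; rewrite -cmod_sqr -powR_mulrn ?cmod_ge0//.
  by rewrite -powRrM mulfV ?pnatr_eq0// powRr1 ?cmod_ge0.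
apply: (measurableT_comp (measurable_powR _)).
by apply: measurable_funD; exact: measurable_funX.
Qed.

Lemma ccvg_ReIm (u : nat -> R[i]^o) (l : R[i]^o) : u @ \oo --> l ->
  ((fun n => complex.Re (u n)) @ \oo --> complex.Re l) /\
  ((fun n => complex.Im (u n)) @ \oo --> complex.Im l).
Proof.
move=> /ccvgP /cvgrPdist_lt ul; split; apply/cvgrPdist_lt => e e0;
  apply: filterS (ul _ e0) => n;
  rewrite sub0r normrN ger0_norm ?cmod_ge0// cmodB => un.
  by rewrite -ReB; exact: le_lt_trans (le_Re_cmod _) un.
by rewrite -ImB; exact: le_lt_trans (le_Im_cmod _) un.
Qed.

Lemma ReIm_ccvg (u : nat -> R[i]^o) (l : R[i]^o) :
  ((fun n => complex.Re (u n)) @ \oo --> complex.Re l) ->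
  ((fun n => complex.Im (u n)) @ \oo --> complex.Im l) -> u @ \oo --> l.
Proof.
move=> u1 u2; apply/ccvgP.
apply: (@squeeze_cvgr _ _ _ _ (cst 0)
  (fun n => `|complex.Re (u n) - complex.Re l| + `|complex.Im (u n) - complex.Im l|)).
- apply: nearW => n; rewrite cmod_ge0 /=.
  by apply: le_trans (cmod_le_ReIm _) _; rewrite ReB ImB.
- exact: cvg_cst.
- rewrite -[0 in X in _ --> X](addr0 0); apply: cvgD.
    have := cvg_norm (cvgB u1 (cvg_cst (complex.Re l))).
    by rewrite subrr normr0; exact.
  have := cvg_norm (cvgB u2 (cvg_cst (complex.Im l))).
  by rewrite subrr normr0; exact.
Qed.

Lemma cmeasurable_lim (G : nat -> T -> R[i]^o) (g : T -> R[i]^o) :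
  (forall n, cmeasurable (G n)) ->
  (forall t, D t -> (fun n => G n t) @ \oo --> g t) -> cmeasurable g.
Proof.
move=> mG Gg; split.
  apply: (@measurable_fun_cvg _ _ _ _ (fun n t => complex.Re (G n t))).
    by move=> n; case: (mG n).
  by move=> t /Gg /ccvg_ReIm [].
apply: (@measurable_fun_cvg _ _ _ _ (fun n t => complex.Im (G n t))).
  by move=> n; case: (mG n).
by move=> t /Gg /ccvg_ReIm [].
Qed.

End complex_measurability.

(** * Uniform approximation by partial sums and its discrete averages *)

Section power_series.
Variables (R : realType) (f : R[i]^o -> R[i]^o) (a : nat -> R[i]^o).
Hypothesis fa : forall z : R[i]^o, unit_disc z ->
  series (fun k => a k * z ^+ k : R[i]^o) @ \oo --> f z.

Definition psum (n : nat) (z : R[i]) : R[i] := \sum_(0 <= k < n) a k * z ^+ k.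

Lemma psum_cvg z : cmod z < 1 -> (fun n => psum n z : R[i]^o) @ \oo --> f z.
Proof. by move=> z1; exact: fa. Qed.

(** At the midpoint t of r and 1 the series converges, so its terms are bounded; the ratio is then s
    = r / t. *)
Lemma coef_geometric (r : R) : 0 <= r < 1 ->
  exists B s : R, [/\ 0 <= B, 0 <= s < 1 &
    forall k, cmod (a k) * r ^+ k <= B * s ^+ k].
Proof.
move=> /andP[r0 r1]; pose t := (1 + r) / 2.
have t0 : 0 < t by rewrite /t; lra.
have t1 : t < 1 by rewrite /t; lra.
have rt : r < t by rewrite /t; lra.
have tc : cmod (t%:C : R[i]) < 1 by rewrite cmod_real ger0_norm// ltW.
have /cvgP/cvg_series_cvg_0 : series (fun k => a k * t%:C ^+ k : R[i]^o) @ \oo --> f t%:C.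
  exact: fa.
move=> /ccvgP /cvgP /cvg_seq_bounded [B0 [_ hB]].
have {}hB k : cmod (a k) * t ^+ k <= B0 + 1.
  have lt1 : B0 < B0 + 1 by rewrite ltrDl.
  have := hB _ lt1 k I.
  by rewrite /= ger0_norm ?cmod_ge0// subr0 cmodM cmodX cmod_real (gtr0_norm t0).
have B1 : 0 <= B0 + 1.
  by apply: le_trans (hB 0%N); rewrite mulr_ge0 ?cmod_ge0// exprn_ge0// ltW.
exists (B0 + 1), (r / t); split => //.
  by rewrite divr_ge0// ?ltW//= ltr_pdivrMr// mul1r.
move=> k; rewrite expr_div_n mulrA ler_pdivlMr ?exprn_gt0// mulrAC.
by rewrite ler_wpM2r// exprn_ge0.
Qed.

(** Weierstrass test with the geometric majorant of [coef_geometric]. *)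
Lemma psum_uniform (r e : R) : 0 <= r < 1 -> 0 < e ->
  exists N : nat, forall n z, (N <= n)%N -> cmod z <= r ->
    cmod (psum n z - f z) <= e.
Proof.
move=> r01 e0; have [B [s [B0 /andP[s0 s1] hB]]] := coef_geometric r01.
have s1' : 0 < 1 - s by rewrite subr_gt0.
have tail n m z : (n <= m)%N -> cmod z <= r ->
    cmod (psum m z - psum n z) <= B / (1 - s) * s ^+ n.
  move=> nm zr; rewrite /psum (@big_cat_nat _ _ _ n 0%N m)//= [X in X - _]addrC addrK.
  apply: (le_trans (le_cmod_sum _ _ _)).
  apply: (@le_trans _ _ (\sum_(n <= k < m) B * s ^+ k)).
    apply: ler_sum => k _; rewrite cmodM cmodX; apply: le_trans (hB k).
    by rewrite ler_wpM2l ?cmod_ge0// lerXn2r ?nnegrE ?cmod_ge0//; case/andP: r01.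
  rewrite -mulr_sumr -mulrA ler_wpM2l// ler_pdivlMl//.
  suff -> : (1 - s) * \sum_(n <= k < m) s ^+ k = s ^+ n - s ^+ m.
    by rewrite lerBlDr lerDl exprn_ge0.
  elim: m nm => [|m IH].
    by rewrite leqn0 => /eqP ->; rewrite big_geq// mulr0 subrr.
  rewrite leq_eqVlt => /orP[/eqP <-|]; first by rewrite big_geq// mulr0 subrr.
  by rewrite ltnS => nm; rewrite big_nat_recr//= mulrDr IH// exprS; ring.
have : (fun n => B / (1 - s) * s ^+ n) @ \oo --> (0 : R).
  rewrite -[0 in X in _ --> X](mulr0 (B / (1 - s))).
  by apply: cvgMr; apply: cvg_expr; rewrite ger0_norm.
move=> /cvgrPdist_le /(_ _ e0) [N _ hN]; exists N => n z Nn zr.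
have zf : cmod z < 1 by apply: le_lt_trans zr _; case/andP: r01.
(* The Cauchy estimate [tail] is passed to the limit: the index N' where the partial sums come
   within x of f z depends on z, but only x survives, and x is arbitrary. *)
have := psum_cvg zf => /ccvgP /cvgrPdist_le H.
apply/ler_addgt0Pl => x x0; have [N' _ hN'] := H _ x0.
have := hN' (maxn n N') (leq_maxr _ _); rewrite /= sub0r normrN ger0_norm ?cmod_ge0// => h1.
have -> : psum n z - f z = (psum (maxn n N') z - f z) - (psum (maxn n N') z - psum n z).
  by ring.
apply: (le_trans (le_cmodD _ _)); rewrite cmodN lerD//.
apply: (le_trans (tail _ _ _ (leq_maxl _ _) zr)).
by apply: le_trans (hN n Nn); rewrite /= sub0r normrN ler_norm.
Qed.

Lemma cmeasurable_pseries d (T : measurableType d) (D : set T) (phi : T -> R[i]) :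
  cmeasurable D phi -> (forall t, D t -> cmod (phi t) < 1) ->
  cmeasurable D (fun t => f (phi t)).
Proof.
move=> mphi phi1.
apply: (@cmeasurable_lim _ _ _ _ (fun n t => psum n (phi t))); last first.
  by move=> t /phi1; exact: psum_cvg.
move=> n; apply: cmeasurable_sum => k; apply: cmeasurableM.
  exact: cmeasurable_cst.
exact: cmeasurableX.
Qed.

Lemma psum_horner n z : psum n z = (\poly_(i < n) a i).[z].
Proof. by rewrite horner_poly /psum big_mkord. Qed.

(** Recentring the polynomial at z does not raise its degree, so its average over the rotated points
    is exactly its value at the centre. *)
Lemma mean_value_psum n M z u : (0 < M)%N -> (n <= M)%N ->
  \sum_(j < M) psum n (z + rootu R M ^+ j * u) = M%:R * psum n z.
Proof.
move=> M0 nM; pose q := (\poly_(i < n) a i) \Po ('X + z%:P).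
have qE w : psum n (z + w) = q.[w].
  by rewrite psum_horner horner_comp hornerD hornerX hornerC addrC.
under eq_bigr do rewrite qE.
rewrite sum_rootu_horner//; last first.
  apply: leq_trans nM; rewrite size_comp_poly2 ?size_poly//.
  by rewrite size_XaddC.
by rewrite -horner_coef0 -qE addr0.
Qed.

(* The average over the rotated points reproduces polynomials exactly, so a
   uniform polynomial approximation suffices; [t <= l + t ^ p l ^ (1 - p)]
   replaces Jensen's inequality. *)
Lemma discrete_submean (p r : R) z : 1 < p -> 0 <= r -> cmod z + r < 1 ->
  exists2 M : nat, (0 < M)%N & forall u, cmod u <= r ->
    M%:R * (cmod (f z) / 4) `^ p <=
    \sum_(j < M) cmod (f (z + rootu R M ^+ j * u)) `^ p.
Proof.
move=> p1 r0 zr.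
have p0 : 0 < p by lra.
have [fz|fz] := eqVneq (f z) 0.
  exists 1%N => // u _; rewrite fz cmod0 mul0r powR0 ?gt_eqF// mulr0.
  by apply: sumr_ge0 => j _; exact: powR_ge0.
have fz0 : 0 < cmod (f z) by rewrite lt_neqAle eq_sym cmod_eq0 fz cmod_ge0.
(* Budget for |f z|: one half goes to the level l of [young], one eighth to each of two
   approximation errors (at z and at the rotated points). A quarter remains for the mean of the p-th
   powers. *)
pose l := cmod (f z) / 2.
have l0 : 0 < l by rewrite divr_gt0.
have r01 : 0 <= cmod z + r < 1 by rewrite zr addr_ge0// cmod_ge0.
have e0 : 0 < cmod (f z) / 8 by rewrite divr_gt0.
have [N hN] := psum_uniform r01 e0.
exists N.+1 => // u ur; set M := N.+1.
have M0 : 0 < M%:R :> R by rewrite ltr0n.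
have wu j : cmod (rootu R M ^+ j * u) = cmod u.
  by rewrite cmodM cmodX cmod_rootu expr1n mul1r.
have h1 : cmod (psum M z) <= M%:R^-1 * \sum_(j < M)
     (cmod (f (z + rootu R M ^+ j * u)) + cmod (f z) / 8).
  rewrite ler_pdivlMl//.
  rewrite -cmod_nat -cmodM -(mean_value_psum z u (ltn0Sn _) (leqnn _)).
  apply: (le_trans (le_cmod_sum _ _ _)); apply: ler_sum => j _.
  rewrite -[psum _ _](subrK (f (z + rootu R M ^+ j * u))) addrC.
  apply: (le_trans (le_cmodD _ _)); rewrite lerD2l hN ?leqnSn//.
  by apply: le_trans (le_cmodD _ _) _; rewrite wu lerD2l.
have h2 : cmod (f z) <= cmod (psum M z) + cmod (f z) / 8.
  rewrite addrC -lerBlDr; apply: (le_trans (le_cmodB _ _)).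
  by rewrite cmodB hN ?leqnSn// lerDl.
have young t : 0 <= t -> t <= l + t `^ p * l `^ (1 - p).
  move=> t0; have [tl|lt] := leP t l.
    by rewrite (le_trans tl)// lerDl mulr_ge0// powR_ge0.
  rewrite -[leLHS]add0r lerD//; first exact: ltW.
  have t0' : 0 < t by apply: lt_trans lt.
  have {1}-> : t = t `^ p * t `^ (1 - p).
    rewrite -powRD; last by apply/implyP => _; rewrite gt_eqF.
    by rewrite addrC subrK powRr1// ltW.
  rewrite ler_wpM2l ?powR_ge0//.
  rewrite -(opprB p 1) !powRN lef_pV2 ?posrE ?powR_gt0//.
  by rewrite ge0_ler_powR ?nnegrE ?ltW//; lra.
have h3 : cmod (f z) / 4 <= M%:R^-1 *
    \sum_(j < M) cmod (f (z + rootu R M ^+ j * u)) `^ p * l `^ (1 - p).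
  have : M%:R^-1 * \sum_(j < M) (cmod (f (z + rootu R M ^+ j * u)) + cmod (f z) / 8)
    <= M%:R^-1 * \sum_(j < M) (l + cmod (f (z + rootu R M ^+ j * u)) `^ p * l `^ (1 - p)
       + cmod (f z) / 8).
    rewrite ler_wpM2l ?invr_ge0 ?ler0n//; apply: ler_sum => j _.
    by rewrite lerD2r young ?cmod_ge0.
  set S := \sum_(j < M) _ * _.
  have -> : \sum_(j < M) (l + cmod (f (z + rootu R M ^+ j * u)) `^ p * l `^ (1 - p)
      + cmod (f z) / 8) = M%:R * l + S + M%:R * (cmod (f z) / 8).
    by rewrite !big_split /= !sumr_const card_ord !mulr_natl.
  rewrite !mulrDr !mulKf ?gt_eqF//.
  have : l = cmod (f z) / 2 by [].
  move: h1 h2; set X := M%:R^-1 * _; set Y := M%:R^-1 * _.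
  by move: X Y (cmod (psum M z)) => X Y W; lra.
have lE : l `^ (1 - p) * l `^ p = l.
  rewrite -powRD; last by apply/implyP => _; rewrite gt_eqF.
  by rewrite subrK powRr1// ltW.
move: h3; rewrite -mulr_suml; set S := \sum_(j < M) _ => h3.
have h4 : l `^ p / 2 * M%:R <= S.
  rewrite -(@ler_pM2r _ (l `^ (1 - p))) ?powR_gt0//.
  have -> : l `^ p / 2 * M%:R * l `^ (1 - p) = M%:R * (cmod (f z) / 4).
    by rewrite -[RHS]mulr1; transitivity (l `^ (1 - p) * l `^ p / 2 * M%:R);
      [ring|rewrite lE /l; field].
  by rewrite -ler_pdivlMl.
(* Here |f z| / 4 = l / 2, and (l / 2)^p <= l^p / 2 because p > 1. *)
apply: le_trans h4; rewrite mulrC ler_wpM2r ?ler0n//.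
have -> : cmod (f z) / 4 = l / 2 by rewrite /l; field.
rewrite powRM ?invr_ge0 ?(ltW l0)// ler_wpM2l ?powR_ge0//.
have -> : 2^-1 = (2 `^ (-1)) :> R by rewrite powR_inv1.
rewrite -powRrM ler_powR ?ler1n//; lra.
Qed.

(** A partial sum of length M >= n lies within 1 of f on the circle, so its squared modulus is at
    most 2 |f|^2 + 2, and Parseval applies to it exactly. M depends on r and n, not on the point z,
    which later allows integration in z. *)
Lemma discrete_Bessel (r : R) (n : nat) : 0 <= r < 1 ->
  exists2 M : nat, (0 < M)%N & forall z, cmod z = r ->
    M%:R * \sum_(k < n) cmod (a k) ^+ 2 * r ^+ k.*2 <=
    \sum_(j < M) (2 * cmod (f (rootu R M ^+ j * z)) ^+ 2 + 2).
Proof.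
move=> r01; have [N hN] := psum_uniform r01 ltr01.
exists (maxn N n).+1 => // z zr; set M := (maxn N n).+1.
have nM : (n <= M)%N by rewrite (leq_trans (leq_maxr N n)).
have NM : (N <= M)%N by rewrite (leq_trans (leq_maxl N n)).
have wz j : cmod (rootu R M ^+ j * z) = r.
  by rewrite cmodM cmodX cmod_rootu expr1n mul1r.
apply: (@le_trans _ _ (M%:R * \sum_(k < M) cmod (a k) ^+ 2 * r ^+ k.*2)).
  rewrite ler_wpM2l ?ler0n// -!(big_mkord xpredT (fun k => cmod (a k) ^+ 2 * r ^+ k.*2)).
  rewrite (@big_cat_nat _ _ _ n 0%N M)//= lerDl sumr_ge0// => k _.
  by rewrite mulr_ge0 ?exprn_ge0 ?cmod_ge0//; case/andP: r01.
rewrite -zr -discrete_Parseval//; apply: ler_sum => j _.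
have -> : \sum_(k < M) a k * (rootu R M ^+ j * z) ^+ k = psum M (rootu R M ^+ j * z).
  by rewrite /psum big_mkord.
have h1 := hN M (rootu R M ^+ j * z) NM.
have := h1; rewrite wz lexx => /(_ isT) {}h1.
have := le_cmodD (psum M (rootu R M ^+ j * z) - f (rootu R M ^+ j * z)) (f (rootu R M ^+ j * z)).
rewrite subrK => h2.
have := cmod_ge0 (psum M (rootu R M ^+ j * z)).
have := cmod_ge0 (f (rootu R M ^+ j * z)).
move: h1 h2; set x := cmod (psum _ _ - _); set t := cmod (psum _ _); set y := cmod _.
move=> x1 txy y0 t0; have ty : t <= y + 1 by lra.
have : t ^+ 2 <= (y + 1) ^+ 2 by rewrite lerXn2r ?nnegrE//; lra.
have : 0 <= (y - 1) ^+ 2 by rewrite sqr_ge0.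
by nra.
Qed.

End power_series.

(** * Tent regions *)

Lemma sume_ord_const (R : realType) (x : \bar R) (M : nat) :
  (\sum_(j < M) x = M%:R%:E * x)%E.
Proof.
elim: M => [|M IH]; first by rewrite big_ord0 mul0e.
by rewrite big_ord_recr/= IH -natr1 EFinD ge0_muleDl ?mul1e// lee_fin ler0n.
Qed.

(** * Submean inequality over planar discs *)

Section area.
Variable R : realType.
Local Notation L2 := (@lebesgue_measure R \x @lebesgue_measure R)%E.
Local Notation plane := (measurableTypeR R * measurableTypeR R)%type.

Definition pt (w : plane) : R[i] := w.1 +i* w.2.

Lemma cmeasurable_pt (D : set plane) : cmeasurable D pt.
Proof. by split; apply: measurable_funTS => /=; [exact: measurable_fst|exact: measurable_snd]. Qed.

Definition pdisc (z : R[i]) (r : R) : set plane := [set w | cmod (pt w - z) < r].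

Lemma measurable_pdisc z r : measurable (pdisc z r).
Proof.
have : measurable_fun setT (fun w : plane => cmod (pt w - z)).
  apply: measurable_cmod; apply: cmeasurableD; first exact: cmeasurable_pt.
  exact: cmeasurable_cst.
move=> /(_ measurableT _ (measurable_itv `]-oo, r[)); rewrite setTI.
by congr measurable; apply/seteqP; split => w /=; rewrite in_itv.
Qed.

(** The inscribed square of side r is enough, as constants are not tracked. *)
Lemma pdisc_area_ge (r : R) : 0 < r -> ((r ^+ 2)%:E <= L2 (pdisc 0%R r))%E.
Proof.
move=> r0.
have -> : (r ^+ 2)%:E = L2 (`](- r / 2), (r / 2)[ `*` `](- r / 2), (r / 2)[).
  rewrite product_measure1E//= !lebesgue_measure_itv /= lte_fin.
  rewrite ifT; last by lra.
  by rewrite -EFinD -EFinM; congr (_%:E); field.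
apply: le_measure; rewrite ?inE.
- exact: measurableX.
- exact: measurable_pdisc.
move=> [x y] /= []; rewrite !in_itv /= => /andP[x1 x2] /andP[y1 y2].
rewrite -[pdisc _ _ _]/(is_true (cmod _ < _)) subr0.
rewrite -(@ltr_pXn2r _ 2)// ?nnegrE ?cmod_ge0 ?(ltW r0)//.
by rewrite cmod_sqr /=; nra.
Qed.

Lemma pt_translation z w : pt (w.1 + complex.Re z, w.2 + complex.Im z) = pt w + z.
Proof. by case: z w => a b [x y]. Qed.

Lemma plane_invariant_mul (c : R[i]) : cmod c = 1 ->
  exists2 phi : plane -> plane, plane_invariant phi &
    forall w, pt (phi w) = c * pt w.
Proof.
move=> c1.
exists (fun w => (complex.Re c * w.1 - complex.Im c * w.2,
                  complex.Im c * w.1 + complex.Re c * w.2)).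
  by apply: plane_invariant_rotation; rewrite -cmod_sqr c1 expr1n.
move=> [x y]; case: c c1 => a b _ /=; rewrite /pt /=.
apply/eqP; rewrite eq_complex /= eqxx /=; apply/eqP; ring.
Qed.

Variables (f : R[i]^o -> R[i]^o) (a : nat -> R[i]^o).
Hypothesis fa : forall z : R[i]^o, unit_disc z ->
  series (fun k => a k * z ^+ k : R[i]^o) @ \oo --> f z.

(** One M serves all points of the disc, so the discrete inequality can be integrated over it. By
    rotation invariance the M terms have the same integral, and M cancels. *)
Lemma area_submean (p r : R) z : 1 < p -> 0 < r -> cmod z + r < 1 ->
  ((r ^+ 2 * (cmod (f z) / 4) `^ p)%:E <=
   \int[L2]_(w in pdisc z r) (cmod (f (pt w)) `^ p)%:E)%E.
Proof.
move=> p1 r0 zr.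
have [M M0 hM] := discrete_submean fa p1 (ltW r0) zr.
set c := (cmod (f z) / 4) `^ p in hM *.
have c0 : 0 <= c by exact: powR_ge0.
(* Extension by zero and translation of the centre to the origin make the integrals range over the
   whole plane, where the rotations act. *)
pose g w : \bar R := (((fun w => (cmod (f (pt w)) `^ p)%:E) \_ (pdisc z r)) w)%E.
pose g0 (w : plane) : \bar R := g (w.1 + complex.Re z, w.2 + complex.Im z).
have gint : (\int[L2]_(w in pdisc z r) (cmod (f (pt w)) `^ p)%:E = \int[L2]_w g w)%E.
  by rewrite integral_mkcond.
have g_ge0 w : (0 <= g w)%E.
  by rewrite /g patchE; case: ifPn => // _; rewrite lee_fin powR_ge0.
have mg : measurable_fun setT g.
  apply/(measurable_restrictT _ (measurable_pdisc z r)).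
  apply/measurable_EFinP; apply: (measurableT_comp (measurable_powR _)).
  apply: measurable_cmod; apply: (cmeasurable_pseries fa).
    exact: cmeasurable_pt.
  move=> w wz; rewrite -(subrK z (pt w)) (le_lt_trans (le_cmodD _ _))//.
  by rewrite (lt_le_trans _ (ltW zr))// addrC ltrD2l.
have [mt it] := plane_invariant_translation (complex.Re z) (complex.Im z).
have g0int : (\int[L2]_w g0 w = \int[L2]_w g w)%E by exact: it.
have mg0 : measurable_fun setT g0 by exact: measurableT_comp mg mt.
have rot j := plane_invariant_mul (etrans (cmodX (rootu R M) j)
  (etrans (congr1 (fun x => x ^+ j) (cmod_rootu R M)) (expr1n _ j))).
pose phi j := sval (cid2 (rot j)).
have phiinv j : plane_invariant (phi j) by rewrite /phi; case: cid2.
have phiE j w : pt (phi j w) = rootu R M ^+ j * pt w.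
  by rewrite /phi; case: cid2 => /= ? _; apply.
have gE u : cmod u < r -> forall w, pt w = u ->
    g0 w = (cmod (f (z + u)) `^ p)%:E.
  move=> ur w wu; rewrite /g0 /g patchE pt_translation wu [u + z]addrC mem_set//.
  by rewrite /pdisc /mkset pt_translation wu addrK.
have g0_ge0 w : (0 <= g0 w)%E by exact: g_ge0.
rewrite gint -g0int; clear gint g0int it mg; clearbody g0 phi; clear g g_ge0.
have : (\int[L2]_(w in pdisc 0%R r) (M%:R * c)%:E <=
        \int[L2]_w (\sum_(j < M) g0 (phi j w)))%E.
  apply: ge0_subset_le_integral => //.
    move=> w; rewrite /pdisc /mkset subr0 => wr; rewrite lee_fin mulr_ge0 ?ler0n// andTb.
    rewrite (eq_bigr (fun j : 'I_M => (cmod (f (z + rootu R M ^+ j * pt w)) `^ p)%:E)).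
      by rewrite sumEFin lee_fin hM// ltW.
    move=> j _; apply: gE; last exact: phiE.
    by rewrite cmodM cmodX cmod_rootu expr1n mul1r.
  by move=> w _; apply: sume_ge0 => j _; exact: g0_ge0.
rewrite ge0_integral_sum//; last first.
  by move=> j; have [mphi _] := phiinv j; exact: measurableT_comp mg0 mphi.
rewrite (eq_bigr (fun=> \int[L2]_w g0 w)%E); last first.
  by move=> j _; have [_ /(_ g0 mg0)->] := phiinv j; [|move=> w; exact: g0_ge0].
rewrite sume_ord_const.
rewrite integral_cst; last exact: measurable_pdisc.
move=> H; rewrite -(@lee_pmul2l _ M%:R%:E) ?lte_fin ?ltr0n//.
apply: le_trans H; rewrite -EFinM mulrCA mulrC EFinM.
by rewrite lee_wpmul2l ?pdisc_area_ge// lee_fin mulr_ge0 ?ler0n.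
Qed.
End area.

(** * Discs inside tent regions and the lower bound for the area integral *)

Section tent.
Variable R : realType.
Local Notation plane := (measurableTypeR R * measurableTypeR R)%type.

Lemma lipschitz_derivable1 (g dg : R -> R) (x y : R) :
  (forall t : R, is_derive t 1 g (dg t)) -> (forall t, `|dg t| <= 1) ->
  `|g x - g y| <= `|x - y|.
Proof.
move=> hg hdg; wlog xy : x y / y <= x.
  move=> H; have [yx|/ltW xy] := leP y x; first exact: H.
  by rewrite distrC [leRHS]distrC H.
have [|c _ ->] := @MVT_segment R g dg y x xy.
- apply: continuous_subspaceT => t.
  have hgt := hg t.
  by apply: differentiable_continuous; apply/derivable1_diffP; exact: ex_derive.
by rewrite normrM ler_piMl.
Qed.

(** The factor 2 adds the bounds for the two coordinates; it is what turns an angular gap (1 - r) /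
    8 into a distance (1 - r) / 4. *)
Lemma cis_lipschitz (x y : R) : cmod (cis x - cis y) <= 2 * `|x - y|.
Proof.
apply: (le_trans (cmod_le_ReIm _)); rewrite ReB ImB mulr_natl mulr2n lerD//=.
  apply: (@lipschitz_derivable1 cos (fun t => - sin t)) => t.
  by rewrite normrN sin_max.
apply: (@lipschitz_derivable1 sin cos) => t.
exact: cos_max.
Qed.

Lemma Gamma_half_disc (xi z : R[i]) : cmod xi = 1 -> Gamma_half xi z -> cmod z < 1.
Proof.
move=> xi1 [[]//|[z0 /= z01 [s /andP[s0 s1] ->]]].
apply: (le_lt_trans (le_cmodD _ _)); rewrite !cmodM !cmod_real xi1 mulr1.
rewrite (ger0_norm s0) ger0_norm; last by lra.
by have := cmod_ge0 z0; nra.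
Qed.

(** With d = 1 - r, the point w is d z0 + r e^(i theta) for z0 = (w - r e^(i theta)) / d. Its
    distance to r e^(i theta) is less than d / 4 + 2 d / 8 = d / 2, so |z0| < 1/2, the aperture of
    the tent. *)
Lemma pdisc_sub_Gamma_half (r phi theta : R) (w : plane) : 0 <= r < 1 ->
  `|phi - theta| <= (1 - r) / 8 -> pdisc (r%:C * cis phi) ((1 - r) / 4) w ->
  Gamma_half (cis theta) (pt w).
Proof.
move=> /andP[r0 r1] pt8; rewrite /pdisc /mkset => wr; right.
have d0 : 0 < 1 - r by lra.
have dC : (1 - r)%:C != 0 :> R[i] by rewrite (inj_eq (@complexI R) _ 0) gt_eqF.
exists ((pt w - r%:C * cis theta) / (1 - r)%:C).
  rewrite /mkset cmodM cmodV cmod_real gtr0_norm// ltr_pdivrMr//.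
  have -> : pt w - r%:C * cis theta =
     (pt w - r%:C * cis phi) + r%:C * (cis phi - cis theta) by ring.
  apply: (le_lt_trans (le_cmodD _ _)).
  have : cmod (r%:C * (cis phi - cis theta)) <= (1 - r) / 4.
    rewrite cmodM cmod_real ger0_norm//.
    have := cis_lipschitz phi theta; have := cmod_ge0 (cis phi - cis theta).
    by nra.
  lra.
exists r; first by rewrite r0.
by rewrite mulrC divfK// addrNK.
Qed.

Variables (f : R[i]^o -> R[i]^o) (a : nat -> R[i]^o).
Hypothesis fa : forall z : R[i]^o, unit_disc z ->
  series (fun k => a k * z ^+ k : R[i]^o) @ \oo --> f z.

Lemma cmod_polar (r theta : R) : 0 <= r -> cmod (r%:C * cis theta) = r.
Proof. by move=> r0; rewrite cmodM cmod_cis mulr1 cmod_real ger0_norm. Qed.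

Lemma tent_lower (p : R) : 1 < p -> exists2 c, 0 < c &
  forall r phi theta : R, 0 <= r < 1 -> `|phi - theta| <= (1 - r) / 8 ->
  ((c * (1 - r) * cmod (f (r%:C * cis phi)) `^ p)%:E <=
  area_integral (Gamma_half (cis theta))
    (fun z => (cmod (f z) `^ p / (1 - cmod z ^+ 2))%R))%E.
Proof.
move=> p1; exists (pi^-1 * (2 / 5 / 16) * (4^-1) `^ p).
  by rewrite !mulr_gt0 ?invr_gt0 ?pi_gt0 ?powR_gt0 ?invr_gt0.
move=> r phi theta r01 pt8; have /andP[r0 r1] := r01.
have d0 : 0 < 1 - r by lra.
set z := r%:C * cis phi.
have zr : cmod z = r by rewrite cmod_polar.
have h1 : 0 < (1 - r) / 4 by lra.
have h2 : cmod z + (1 - r) / 4 < 1 by rewrite zr; lra.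
have w1 w : pdisc z ((1 - r) / 4) w ->
    cmod (pt w) < 1 /\ 1 - cmod (pt w) ^+ 2 <= 5 / 2 * (1 - r).
  rewrite /pdisc /mkset => wz.
  have := le_cmodD (pt w - z) z; rewrite subrK zr => a1.
  have := le_cmodB z (pt w); rewrite zr cmodB => a2.
  have := cmod_ge0 (pt w) => a3.
  by split; [lra|nra].
have := area_submean fa p1 h1 h2; set I := integral _ _ _ => HI.
rewrite /area_integral.
apply: (@le_trans _ _ ((pi^-1)%:E * ((2 / 5 / (1 - r))%:E * I))%E).
  apply: (@le_trans _ _ ((pi^-1)%:E * ((2 / 5 / (1 - r))%:E *
      (((1 - r) / 4) ^+ 2 * (cmod (f z) / 4) `^ p)%:E))%E); last first.
    rewrite lee_wpmul2l ?lee_fin ?invr_ge0 ?pi_ge0//.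
    by rewrite lee_wpmul2l// lee_fin divr_ge0// ltW.
  rewrite -!EFinM lee_fin powRM ?cmod_ge0 ?invr_ge0//.
  rewrite le_eqVlt; apply/orP; left; apply/eqP.
  have := gt_eqF (pi_gt0 R); move: (pi : R) => P P0; field.
  by rewrite (gt_eqF d0) P0.
rewrite lee_wpmul2l ?lee_fin ?invr_ge0 ?pi_ge0//.
rewrite /I -ge0_integralZl//; last 4 first.
- exact: measurable_pdisc.
- apply/measurable_EFinP; apply: (measurableT_comp (measurable_powR _)).
  apply: measurable_cmod; apply: (cmeasurable_pseries fa).
    exact: cmeasurable_pt.
  by move=> w /w1[].
- by move=> w _; rewrite lee_fin powR_ge0.
- by rewrite lee_fin divr_ge0// ltW.
apply: ge0_subset_le_integral.
- by move=> w; exact: pdisc_sub_Gamma_half.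
- move=> w /w1 [ww1 ww2]; rewrite -EFinM !lee_fin mulr_ge0 ?powR_ge0 ?divr_ge0 ?(ltW d0)// andTb.
  have ww0 : 0 < 1 - cmod (pt w) ^+ 2.
    by rewrite subr_gt0 expr_lt1// cmod_ge0.
  rewrite mulrC ler_wpM2l ?powR_ge0// -[leRHS]mul1r ler_pdivlMr// mulrAC.
  by rewrite ler_pdivrMr// ; lra.
- move=> w /Gamma_half_disc; rewrite cmod_cis => /(_ erefl) ww1.
  by rewrite lee_fin divr_ge0 ?powR_ge0// subr_ge0 ltW// expr_lt1// cmod_ge0.
Qed.

End tent.

(** * Integral means of f on circles *)

Section circle_bounds.
Variables (R : realType) (f : R[i]^o -> R[i]^o) (a : nat -> R[i]^o).
Hypothesis fa : forall z : R[i]^o, unit_disc z ->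
  series (fun k => a k * z ^+ k : R[i]^o) @ \oo --> f z.
Local Notation L := (@lebesgue_measure R).

Lemma cmeasurable_polar (D : set (measurableTypeR R)) (r : R) :
  cmeasurable D (fun theta : measurableTypeR R => r%:C * cis theta).
Proof.
apply: cmeasurableM; first exact: cmeasurable_cst.
split; apply: measurable_funTS => /=; apply: continuous_measurable_fun.
  exact: continuous_cos.
exact: continuous_sin.
Qed.

Lemma measurable_circle_powR (D : set (measurableTypeR R)) (r s : R) : 0 <= r < 1 ->
  measurable_fun D (fun theta : measurableTypeR R => cmod (f (r%:C * cis theta)) `^ s).
Proof.
move=> /andP[r0 r1]; apply: (measurableT_comp (measurable_powR _)).
apply: measurable_cmod; apply: (cmeasurable_pseries fa).
  exact: cmeasurable_polar.
by move=> t _; rewrite cmod_polar.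
Qed.

Lemma area_integral_ge0 (xi : R[i]) (p : R) : cmod xi = 1 ->
  (0 <= area_integral (Gamma_half xi)
    (fun z => (cmod (f z) `^ p / (1 - cmod z ^+ 2))%R))%E.
Proof.
move=> xi1; rewrite /area_integral mule_ge0 ?lee_fin ?invr_ge0 ?pi_ge0//.
apply: integral_ge0 => w /(Gamma_half_disc xi1) w1.
by rewrite lee_fin divr_ge0 ?powR_ge0// subr_ge0 ltW// expr_lt1// cmod_ge0.
Qed.

Lemma tent_bounds (p q : R) : 1 < p -> 1 < q -> (AT_norm p q f < +oo)%E ->
  exists2 C, 0 < C & forall r : R, 0 <= r < 1 ->
  (\int[L]_(theta in `[0%R, (2 * pi)%R])
      (cmod (f (r%:C * cis theta)) `^ q)%:E <= (C * (1 - r) `^ (- (q / p)))%:E)%E /\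
  (forall phi, phi \in `[0, 2 * pi] ->
     cmod (f (r%:C * cis phi)) `^ q <= C * (1 - r) `^ (- (q / p + 1))).
Proof.
move=> p1 q1 Hf.
have p0 : 0 < p by lra.
have q0 : 0 < q by lra.
have pi0 : 0 < pi :> R := pi_gt0 R.
have pi2 : 2 <= pi :> R := pi_ge2 R.
have [c c0 hc] := tent_lower fa p1.
pose A (theta : R) := area_integral (Gamma_half (cis theta))
    (fun z => (cmod (f z) `^ p / (1 - cmod z ^+ 2))%R).
have A0 theta : (0 <= A theta)%E by apply: area_integral_ge0; exact: cmod_cis.
pose J := (\int[L]_(theta in `[0%R, (2 * pi)%R]) (A theta `^ (q / p)))%E.
have J0 : (0 <= J)%E by apply: integral_ge0 => t _; exact: poweR_ge0.
have [K JK] : exists K, J = K%:E.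
  have : (J `^ (q^-1) < +oo)%E by exact: Hf.
  move=> /lty_poweRy; rewrite invr_neq0 ?gt_eqF// => /(_ isT).
  by move: J0; case: J => // K _ _; exists K.
have K0 : 0 <= K by move: J0; rewrite JK lee_fin.
pose k := c `^ (q / p).
have k0 : 0 < k by exact: powR_gt0.
have point r phi theta : 0 <= r < 1 -> `|phi - theta| <= (1 - r) / 8 ->
    ((k * (1 - r) `^ (q / p) * cmod (f (r%:C * cis phi)) `^ q)%:E
      <= A theta `^ (q / p))%E.
  move=> r01 pt8; have := hc _ _ _ r01 pt8; rewrite -/(A theta) => H.
  have d0 : 0 <= 1 - r by case/andP: r01; lra.
  have qp : 0 <= q / p by rewrite divr_ge0// ltW.
  apply: le_trans (gt0_ler_poweR qp _ _ H).
  - rewrite poweR_EFin lee_fin powRM ?powR_ge0 ?mulr_ge0 ?(ltW c0)//.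
    rewrite powRM ?(ltW c0)// -powRrM.
    by have -> : p * (q / p) = q by field; rewrite gt_eqF.
  - by rewrite in_itv /= leey andbT lee_fin !mulr_ge0 ?powR_ge0// ltW.
  - by rewrite in_itv /= leey andbT.
(* The 8 is (1 - r) / h for the window length h used below; K + 1 replaces K so that the constant is
   positive even when K = 0. *)
exists (8 * (K + 1) / k).
  by rewrite divr_gt0// mulr_gt0//; lra.
move=> r r01; have /andP[r0 r1] := r01.
have d0 : 0 < 1 - r by lra.
have D0 : 0 < (1 - r) `^ (q / p) by exact: powR_gt0.
split.
  have : (\int[L]_(theta in `[0%R, (2 * pi)%R])
     ((k * (1 - r) `^ (q / p))%:E * (cmod (f (r%:C * cis theta)) `^ q)%:E) <= J)%E.
    apply: ge0_subset_le_integral => //.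
      move=> t _; rewrite -EFinM point ?subrr ?normr0 ?divr_ge0// ?(ltW d0)//.
      by rewrite lee_fin !mulr_ge0 ?powR_ge0// ltW.
    by move=> t _; exact: poweR_ge0.
  rewrite ge0_integralZl//; last 3 first.
  - by apply/measurable_EFinP; exact: measurable_circle_powR.
  - by move=> t _; rewrite lee_fin powR_ge0.
  - by rewrite lee_fin mulr_ge0 ?powR_ge0// ltW.
  rewrite JK => H.
  rewrite -(@lee_pmul2l _ (k * (1 - r) `^ (q / p))%:E) ?lte_fin ?mulr_gt0//.
  apply: le_trans H _; rewrite -EFinM lee_fin powRN.
  have -> : k * (1 - r) `^ (q / p) * (8 * (K + 1) / k * ((1 - r) `^ (q / p))^-1) = 8 * (K + 1).
    by field; rewrite !gt_eqF.
  lra.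
move=> phi; rewrite in_itv /= => /andP[phi0 phi2].
pose h := (1 - r) / 8.
have h0 : 0 < h by rewrite /h; lra.
have h1 : h <= 1 / 8 by rewrite /h; lra.
(* A window of length h with phi as its left or right end, the side chosen so that it stays inside
   [0, 2 pi] and no periodic extension is needed. *)
pose b := if phi <= pi then phi else phi - h.
have b0 : 0 <= b /\ b + h <= 2 * pi.
  move: pi2 phi2; rewrite /b; move: (pi : R) => P *.
  by case: (leP phi P) => ?; split; lra.
have bphi t : b <= t <= b + h -> `|phi - t| <= h.
  move=> /andP[]; rewrite ler_norml /b.
  by move: (pi : R) => P; case: (leP phi P) => _ t1 t2; apply/andP; split; lra.
set X := cmod _ `^ q.
have : (\int[L]_(theta in `[b, (b + h)%R]) (k * (1 - r) `^ (q / p) * X)%:E <= J)%E.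
  apply: ge0_subset_le_integral.
  - by move=> t /=; rewrite !in_itv /= => /andP[t1 t2]; lra.
  - move=> t /=; rewrite in_itv /= => /bphi tphi; rewrite point// andbT.
    by rewrite lee_fin !mulr_ge0 ?powR_ge0// ltW.
  - by move=> t _; exact: poweR_ge0.
rewrite integral_cst//= lebesgue_measure_itv /= lte_fin ltrDl h0 -EFinD.
rewrite [b + h]addrC addrK JK -EFinM lee_fin => H.
rewrite powRN powRD ?powRr1 ?(ltW d0)//; last by apply/implyP => _; rewrite gt_eqF.
rewrite -[X](@mulfK _ (k * (1 - r) `^ (q / p) * h)) ?mulf_neq0 ?gt_eqF//.
have -> : 8 * (K + 1) / k / ((1 - r) `^ (q / p) * (1 - r)) =
   (K + 1) / (k * (1 - r) `^ (q / p) * h).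
  by rewrite /h; field; rewrite !gt_eqF.
rewrite ler_pM2r ?invr_gt0 ?mulr_gt0//.
by apply: le_trans (_ : _ <= K) _; [rewrite mulrC mulrAC|lra].
Qed.

Lemma circle_square_bound (p q : R) : 2 < p -> 1 < q -> p^-1 + q^-1 < 1 ->
  (AT_norm p q f < +oo)%E ->
  exists g C : R, [/\ 0 <= g < 1, 0 < C & forall r : R, 0 <= r < 1 ->
  (\int[L]_(theta in `[0%R, (2 * pi)%R])
      (cmod (f (r%:C * cis theta)) ^+ 2)%:E <= (C * (1 - r) `^ (- g))%:E)%E].
Proof.
move=> p2 q1 pq Hf.
have p1 : 1 < p by lra.
have [C C0 hC] := tent_bounds p1 q1 Hf.
have p0 : 0 < p by lra.
have q0 : 0 < q by lra.
have pi0 : 0 < pi :> R := pi_gt0 R.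
have pV : p^-1 < 2^-1 by rewrite ltf_pV2 ?posrE.
have pV0 : 0 < p^-1 by rewrite invr_gt0.
(* It suffices to dominate the square by an affine function of the [q]-th power. *)
have reduce g : 0 <= g < 1 -> (exists C', 0 < C' /\ forall r, 0 <= r < 1 ->
    exists K1 K2, [/\ 0 <= K1 <= C' * (1 - r) `^ (- g),
      0 <= K2, K2 * (1 - r) `^ (- (q / p)) <= C' * (1 - r) `^ (- g) &
      forall phi, phi \in `[0, 2 * pi] -> cmod (f (r%:C * cis phi)) ^+ 2 <=
         K1 + K2 * cmod (f (r%:C * cis phi)) `^ q]) ->
    exists g C : R, [/\ 0 <= g < 1, 0 < C & forall r : R, 0 <= r < 1 ->
  (\int[L]_(theta in `[0%R, (2 * pi)%R])
      (cmod (f (r%:C * cis theta)) ^+ 2)%:E <= (C * (1 - r) `^ (- g))%:E)%E].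
  move=> g01 [C' [C'0 H]]; exists g, (2 * pi * C' + C * C'); split => //.
    by rewrite addr_gt0 ?mulr_gt0.
  move=> r r01; have [K1 [K2 [/andP[K10 K1C] K20 K2C HK]]] := H r r01.
  have [Hr _] := hC _ r01.
  apply: (@le_trans _ _ (\int[L]_(theta in `[0%R, (2 * pi)%R])
      (K1%:E + K2%:E * (cmod (f (r%:C * cis theta)) `^ q)%:E))%E).
    apply: ge0_subset_le_integral => //.
      move=> t /= t2pi; rewrite lee_fin exprn_ge0 ?cmod_ge0//= -EFinM -EFinD lee_fin.
      exact: HK.
    by move=> t _; rewrite -EFinM -EFinD lee_fin addr_ge0// mulr_ge0// powR_ge0.
  have mf : measurable_fun `[0%R, 2 * pi]
      (fun theta => (cmod (f (r%:C * cis theta)) `^ q)%:E).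
    by apply/measurable_EFinP; exact: measurable_circle_powR.
  rewrite ge0_integralD//; last 2 first.
    by move=> t _; rewrite -EFinM lee_fin mulr_ge0// powR_ge0.
    by apply: emeasurable_funM => //; exact: measurable_cst.
  rewrite integral_cst//= lebesgue_measure_itv /= lte_fin mulr_gt0// -EFinD subr0.
  rewrite ge0_integralZl//.
    apply: (@le_trans _ _ ((K1 * (2 * pi))%:E + K2%:E * (C * (1 - r) `^ (- (q / p)))%:E)%E).
      by rewrite EFinM leeD2l// lee_wpmul2l// lee_fin.
    rewrite -EFinM -EFinD lee_fin [leRHS]mulrDl lerD//.
      by rewrite mulrC -mulrA ler_pM2l// mulr_gt0.
    by rewrite mulrCA -mulrA ler_pM2l.
  by move=> t _; rewrite lee_fin powR_ge0.
have [q2|q2] := leP q 2.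
  (* Here |f|^2 = |f|^(2 - q) |f|^q with the supremum bound on the first factor. The exponents add
     up: (q/p + 1) (2 - q)/q + q/p = 2/p + 2/q - 1. *)
  have qV : 2^-1 <= q^-1 by rewrite lef_pV2 ?posrE.
  have qV0 : 0 < q^-1 by rewrite invr_gt0.
  apply: (reduce (2 / p + 2 / q - 1)); first by lra.
  exists (C `^ ((2 - q) / q)); split; first exact: powR_gt0.
  move=> r r01; have /andP[r0 r1] := r01.
  have d0 : 0 < 1 - r by lra.
  have e0 : 0 <= (2 - q) / q by rewrite divr_ge0 ?(ltW q0)// subr_ge0.
  exists 0, ((C * (1 - r) `^ (- (q / p + 1))) `^ ((2 - q) / q)).
  rewrite lexx mulr_ge0 ?powR_ge0//; split => //.
    rewrite powRM ?(ltW C0) ?powR_ge0// -powRrM -mulrA.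
    rewrite -powRD; last by apply/implyP => _; rewrite gt_eqF.
    rewrite le_eqVlt; apply/orP; left; apply/eqP; congr (_ * _ `^ _).
    by field; rewrite !gt_eqF.
  move=> phi phi2; have [_ /(_ _ phi2) H] := hC _ r01.
  rewrite add0r; set X := cmod _ in H *; have X0 : 0 <= X by exact: cmod_ge0.
  have -> : X ^+ 2 = (X `^ q) `^ ((2 - q) / q) * X `^ q.
    rewrite -powRrM.
    have -> : q * ((2 - q) / q) = 2 - q by field; rewrite gt_eqF.
    rewrite -powRD ?subrK ?powR_mulrn//.
    by rewrite pnatr_eq0.
  rewrite ler_wpM2r ?powR_ge0// ge0_ler_powR// ?nnegrE ?powR_ge0//.
  by rewrite mulr_ge0 ?powR_ge0// ltW.
(* For q > 2, Hölder is replaced by a cut at the level l = (1 - r)^(-1/p): below it X^2 <= l^2,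
   above it X^2 <= l^(2 - q) X^q. This level gives both contributions the exponent 2/p. *)
apply: (reduce (2 / p)); first by lra.
exists 1; split => //.
move=> r r01; have /andP[r0 r1] := r01.
have d0 : 0 < 1 - r by lra.
pose l := (1 - r) `^ (- p^-1).
have l0 : 0 < l by exact: powR_gt0.
exists (l ^+ 2), (l `^ (2 - q)); rewrite !mul1r; split.
- rewrite exprn_ge0 ?(ltW l0)//= /l -powR_mulrn ?powR_ge0// -powRrM.
  by rewrite mulrC mulrN.
- exact: powR_ge0.
- rewrite /l -powRrM -powRD; last by apply/implyP => _; rewrite gt_eqF.
  rewrite le_eqVlt; apply/orP; left; apply/eqP; congr (_ `^ _).
  by field; rewrite gt_eqF.
move=> phi _; set X := cmod _; have X0 : 0 <= X by exact: cmod_ge0.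
have [Xl|lX] := leP X l.
  by rewrite -[leLHS]addr0 lerD ?mulr_ge0 ?powR_ge0// lerXn2r ?nnegrE ?(ltW l0).
rewrite -[leLHS]add0r lerD ?exprn_ge0 ?(ltW l0)//.
have X0' : 0 < X by apply: lt_trans lX.
have -> : X ^+ 2 = X `^ (2 - q) * X `^ q.
  by rewrite -powRD ?subrK ?powR_mulrn// pnatr_eq0.
rewrite ler_wpM2r ?powR_ge0// -(opprB q 2) !powRN lef_pV2 ?posrE ?powR_gt0//.
by rewrite ge0_ler_powR ?nnegrE ?(ltW l0) ?(ltW lX)//; lra.
Qed.

End circle_bounds.

(** * Coefficients and Carleson measures *)

Section equidistributed.
Variable R : realType.
Local Notation L := (@lebesgue_measure R).

(** The interval is cut into M half-open windows of length h, all translated back to the first; the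
    sum is then under one integral, where the pointwise bound applies. *)
Lemma ge0_integral_equidistributed (g : measurableTypeR R -> \bar R) (h k : R) (M : nat) :
  measurable_fun setT g -> (forall x, 0 <= g x)%E -> 0 < h -> 0 <= k ->
  (forall x, k%:E <= \sum_(j < M) g (x + h *+ j)%R)%E ->
  ((h * k)%:E <= \int[L]_(x in `[0%R, (h *+ M)%R[) g x)%E.
Proof.
move=> mg g0 h0 k0 H.
have mshift c : measurable_fun setT (fun x : measurableTypeR R => g (x + c)).
  apply: (measurableT_comp mg); exact: measurable_funD.
have shift c : (\int[L]_(x in `[c, (h + c)%R[) g x = \int[L]_(x in `[0%R, h[) g (x + c)%R)%E.
  rewrite [LHS]integral_mkcond -(@ge0_integral_shift _ _ c); last 2 first.
  - by apply/(measurable_restrictT g (measurable_itv _)); exact: measurable_funTS.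
  - by move=> x; rewrite patchE; case: ifP.
  rewrite [RHS]integral_mkcond; apply: eq_integral => x _.
  by rewrite !patchE !mem_setE !in_itv /= -[X in X <= _]add0r lerD2r ltrD2r.
have -> : (\int[L]_(x in `[0%R, (h *+ M)%R[) g x =
    \sum_(j < M) \int[L]_(x in `[0%R, h[) g (x + h *+ j)%R)%E.
  elim: M {H} => [|M IH].
    by rewrite big_ord0 mulr0n set_itvco0 integral_set0.
  have hM : 0 <= h *+ M by rewrite mulrn_wge0// ltW.
  rewrite big_ord_recr /= -IH -shift -mulrS.
  rewrite -ge0_integral_setU//=; last 2 first.
  - exact: measurable_funTS.
  - apply/disj_setPS => x /= [] /=; rewrite !in_itv /= => /andP[_ x1] /andP[x2 _].
    by move: (lt_le_trans x1 x2); rewrite ltxx.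
  congr (integral _ _ _); rewrite -itv_bndbnd_setU// bnd_simp//.
  by rewrite mulrS lerDr ltW.
rewrite -ge0_integral_sum//=; last first.
  by move=> j; exact: measurable_funTS.
have -> : ((h * k)%:E = \int[L]_(x in `[0%R, h[) k%:E)%E.
  by rewrite integral_cst//= lebesgue_measure_itv /= lte_fin h0 -EFinD subr0 -EFinM mulrC.
by apply: ge0_subset_le_integral => // x _; rewrite ?lee_fin ?k0//= ?sume_ge0.
Qed.

End equidistributed.

Section coefficients.
Variables (R : realType) (f : R[i]^o -> R[i]^o) (a : nat -> R[i]^o).
Hypothesis fa : forall z : R[i]^o, unit_disc z ->
  series (fun k => a k * z ^+ k : R[i]^o) @ \oo --> f z.
Local Notation L := (@lebesgue_measure R).

(** Shifting the angle by h = 2 pi / M multiplies the point by the root of unity, so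
    [discrete_Bessel] integrates to 2 pi S <= 2 C (1 - r)^(-g) + 4 pi for the coefficient sum S. The
    additive term is absorbed because (1 - r)^(-g) >= 1. *)
Lemma coef_square_bound (g C : R) : 0 <= g < 1 -> 0 < C ->
  (forall r : R, 0 <= r < 1 ->
  (\int[L]_(theta in `[0%R, (2 * pi)%R])
      (cmod (f (r%:C * cis theta)) ^+ 2)%:E <= (C * (1 - r) `^ (- g))%:E)%E) ->
  forall (r : R) (n : nat), 0 <= r < 1 ->
    \sum_(k < n) cmod (a k) ^+ 2 * r ^+ k.*2 <= (C + 2) * (1 - r) `^ (- g).
Proof.
move=> /andP[g0 g1] C0 hC r n r01; have [M M0 HM] := discrete_Bessel fa n r01.
have /andP[r0 r1] := r01.
have pi0 : 0 < pi :> R := pi_gt0 R.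
have pi2 : 2 <= pi :> R := pi_ge2 R.
set S := \sum_(k < n) _ in HM *.
have S0 : 0 <= S by apply: sumr_ge0 => k _; rewrite mulr_ge0 ?exprn_ge0 ?cmod_ge0.
have d1 : 1 <= (1 - r) `^ (- g).
  rewrite powRN -[leLHS]invr1 lef_pV2 ?posrE ?powR_gt0 ?subr_gt0//.
  have /(_ g) e1 : forall s : R, 1 `^ s = 1 by move=> s; rewrite powR1.
  by rewrite -[leRHS]e1 ge0_ler_powR ?nnegrE//; lra.
pose G theta := 2 * cmod (f (r%:C * cis theta)) ^+ 2 + 2.
pose h : R := 2 * pi / M%:R.
have h0 : 0 < h by rewrite divr_gt0 ?mulr_gt0 ?ltr0n.
have hM : h *+ M = 2 * pi by rewrite -[h *+ M]mulr_natr /h divfK// pnatr_eq0 -lt0n.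
have G0 theta : 0 <= G theta by rewrite addr_ge0// mulr_ge0// exprn_ge0 ?cmod_ge0.
have mf2 (D : set (measurableTypeR R)) :
    measurable_fun D (fun theta => cmod (f (r%:C * cis theta)) ^+ 2).
  apply: measurable_funX; apply: measurable_cmod; apply: (cmeasurable_pseries fa).
    exact: cmeasurable_polar.
  by move=> t _; rewrite cmod_polar.
have mG : measurable_fun setT (fun x : measurableTypeR R => (G x)%:E).
  apply/measurable_EFinP; apply: measurable_funD; last exact: measurable_cst.
  by apply: measurable_funM => //; exact: measurable_cst.
have MS : 0 <= M%:R * S by rewrite mulr_ge0.
have := @ge0_integral_equidistributed R (fun x => (G x)%:E) h (M%:R * S) M mG
  (fun x => G0 x) h0 MS.
have HG x : ((M%:R * S)%:E <= \sum_(j < M) (G (x + h *+ j)%R)%:E)%E.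
  rewrite sumEFin lee_fin; apply: (le_trans (HM (r%:C * cis x) (cmod_polar _ r0))).
  apply: ler_sum => j _; rewrite /G cisD -cisX.
  have -> : r%:C * (cis x * cis h ^+ j) = rootu R M ^+ j * (r%:C * cis x).
    by rewrite /rootu -/h; ring.
  exact: lexx.
move=> /(_ HG); rewrite hM => H1.
have : (\int[L]_(x in `[0%R, (2 * pi)%R[) (G x)%:E <=
        (2 * (C * (1 - r) `^ (- g)) + 2 * (2 * pi))%:E)%E.
  apply: (@le_trans _ _ (\int[L]_(x in `[0%R, (2 * pi)%R])
      (2%:E * (cmod (f (r%:C * cis x)) ^+ 2)%:E + 2%:E))%E).
    apply: ge0_subset_le_integral.
    - by move=> x /=; rewrite !in_itv /= => /andP[-> /ltW].
    - by move=> x _; rewrite -EFinM -EFinD !lee_fin G0 lexx.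
    - by move=> x _; rewrite -EFinM -EFinD lee_fin; exact: G0.
  rewrite ge0_integralD//; last 2 first.
  - by move=> x _; rewrite -EFinM lee_fin mulr_ge0 ?exprn_ge0 ?cmod_ge0.
  - apply: emeasurable_funM; first exact: measurable_cst.
    exact/measurable_EFinP.
  rewrite integral_cst//= lebesgue_measure_itv /= lte_fin mulr_gt0// -EFinD subr0.
  rewrite ge0_integralZl//; last 2 first.
  - exact/measurable_EFinP.
  - by move=> x _; rewrite lee_fin exprn_ge0 ?cmod_ge0.
  rewrite [leRHS]EFinD [X in (_ <= X + _)%E]EFinM [X in (_ <= _ + X)%E]EFinM leeD2r//.
  by rewrite lee_wpmul2l// hC.
move=> /(le_trans H1); rewrite lee_fin.
have -> : h * (M%:R * S) = 2 * pi * S.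
  by rewrite mulrA -hM mulr_natr.
move: pi0 pi2; move: (pi : R) => P P0 P2.
set X := (1 - r) `^ (- g) in d1 *.
have : 0 <= C * X by rewrite mulr_ge0 ?(ltW C0)// powR_ge0.
move: (C * X) (mulrDl C 2 X) => Y -> Y0 H2.
rewrite -(@ler_pM2l _ (2 * P)); last by lra.
by nra.
Qed.

(* AM-GM: [2 |a k| <= x |a k| ^ 2 + x^-1] with [x = (1 - r) ^ ((g - 1) / 2)], which
   balances the two resulting sums. *)
Lemma coef_sum_bound (g C : R) : 0 <= g < 1 -> 0 < C ->
  (forall (r : R) (n : nat), 0 <= r < 1 ->
    \sum_(k < n) cmod (a k) ^+ 2 * r ^+ k.*2 <= C * (1 - r) `^ (- g)) ->
  forall (t : R) (n : nat), 0 <= t < 1 ->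
    \sum_(k < n) cmod (a k) * t ^+ k <=
    (C + 1) * 2 `^ ((1 + g) / 2) * (1 - t) `^ (- ((1 + g) / 2)).
Proof.
move=> /andP[g0 g1] C0 H t n /andP[t0 t1].
(* With t = r^2 the weight t^k is r^(2k), the one occurring in the hypothesis. *)
pose r := Num.sqrt t; have r0 : 0 <= r by exact: sqrtr_ge0.
have tE : t = r ^+ 2 by rewrite sqr_sqrtr.
have r1 : r < 1 by move: t1; rewrite tE expr_lt1.
have d0 : 0 < 1 - r by lra.
have r01 : 0 <= r < 1 by rewrite r0.
set kk := (1 + g) / 2.
pose x := (1 - r) `^ ((g - 1) / 2).
have x0 : 0 < x by exact: powR_gt0.
have geo : \sum_(k < n) r ^+ k.*2 <= (1 - r)^-1.
  have -> : \sum_(k < n) r ^+ k.*2 = \sum_(k < n) t ^+ k.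
    by apply: eq_bigr => k _; rewrite tE -exprM mul2n.
  have t1' : 0 < 1 - t by lra.
  apply: (@le_trans _ _ (1 - t)^-1); last by rewrite lef_pV2 ?posrE// tE; nra.
  rewrite -[leRHS]mul1r ler_pdivlMr// mulrC.
  have := subrX1 t n; have := exprn_ge0 n t0; lra.
have main : \sum_(k < n) cmod (a k) * t ^+ k <= (C + 1) * (1 - r) `^ (- kk).
  apply: (@le_trans _ _ (x * \sum_(k < n) cmod (a k) ^+ 2 * r ^+ k.*2 +
      x^-1 * \sum_(k < n) r ^+ k.*2)).
    rewrite !mulr_sumr -big_split /=; apply: ler_sum => k _.
    rewrite tE -exprM mul2n mulrA -mulrDl ler_wpM2r ?exprn_ge0//.
    have A0 := cmod_ge0 (a k); set A := cmod (a k) in A0 *.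
    rewrite -(@ler_pM2l _ x)// mulrDr mulfV ?gt_eqF//.
    have : 0 <= (x * A - 1) ^+ 2 by rewrite sqr_ge0.
    have : 0 <= x * A by rewrite mulr_ge0// ltW.
    have -> : x * (x * A ^+ 2) = (x * A) ^+ 2 by ring.
    move: (x * A) => B B0; nra.
  have e1 : x * (1 - r) `^ (- g) = (1 - r) `^ (- kk).
    rewrite /x -powRD; last by apply/implyP => _; rewrite gt_eqF.
    by congr (_ `^ _); rewrite /kk; field.
  have e2 : x^-1 * (1 - r)^-1 = (1 - r) `^ (- kk).
    have -> : (1 - r)^-1 = (1 - r) `^ (-1) by rewrite powR_inv1// ltW.
    rewrite /x -powRN -powRD; last by apply/implyP => _; rewrite gt_eqF.
    by congr (_ `^ _); rewrite /kk; field.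
  rewrite mulrDl mul1r -{1}e1 -e2 lerD//.
    by rewrite mulrCA ler_pM2l// H.
  by rewrite ler_pM2l ?invr_gt0.
apply: (le_trans main); rewrite -mulrA ler_pM2l; last by lra.
(* Back from r to t: 1 - t = (1 - r) (1 + r) <= 2 (1 - r), at the cost of the power of 2. *)
have -> : 2 `^ kk * (1 - t) `^ (- kk) = ((1 - t) / 2) `^ (- kk).
  rewrite !powRN powRM ?invr_ge0//; last by lra.
  have -> : 2^-1 `^ kk = (2 `^ kk)^-1.
    by rewrite -[2^-1]powR_inv1// -powRrM mulN1r powRN.
  by rewrite invfM invrK mulrC.
rewrite !powRN lef_pV2 ?posrE ?powR_gt0//; last by rewrite divr_gt0//; lra.
rewrite ge0_ler_powR ?nnegrE//; rewrite /kk ?tE; nra.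
Qed.

End coefficients.

(** * Integration against a Carleson measure *)

Section Carleson.
Variables (R : realType) (mu : {finite_measure set R -> \bar R}).

Lemma one_Carleson_bound : one_Carleson mu ->
  exists2 K : R, 0 <= K & forall t : R, 0 <= t < 1 ->
    (mu [set` `[t, 1%R[] <= (K * (1 - t))%:E)%E.
Proof.
rewrite /one_Carleson; set S := ereal_sup _ => Soo.
have ub t : 0 <= t < 1 -> (mu [set` `[t, 1%R[] * ((1 - t)^-1)%R%:E <= S)%E.
  by move=> t01; apply: ereal_sup_ubound; exists t.
have S0 : (0 <= S)%E.
  by apply: le_trans (ub 0 _); rewrite ?lexx ?ltr01// mule_ge0// lee_fin subr0 invr1.
have [K SK] : exists K, S = K%:E by move: S0 Soo; case: S {ub} => // K _ _; exists K.
exists K; first by move: S0; rewrite SK lee_fin.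
move=> t t01; have := ub t t01; rewrite SK.
have d0 : 0 < 1 - t by rewrite subr_gt0; case/andP: t01.
by rewrite EFinM -lee_pdivrMr// muleC.
Qed.

Lemma ge0_exists_dyadic (x : R) : 0 < x <= 1 ->
  exists j : nat, 2^-1 ^+ j.+1 < x <= 2^-1 ^+ j.
Proof.
move=> /andP[x0 x1].
have ex : exists j : nat, 2^-1 ^+ j.+1 < x.
  have [n hn] : exists n : nat, x^-1 < n%:R.
    by exists (Num.trunc x^-1).+1; rewrite truncnS_gt.
  exists n; rewrite exprVn invf_plt ?posrE ?exprn_gt0//.
  apply: (lt_trans hn); rewrite -natrX ltr_nat.
  by rewrite (leq_trans (ltnSn n))// ltnW// ltn_expl.
case: (ex_minnP ex) => -[|j] hj jmin; first by exists 0%N; rewrite hj expr0.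
exists j.+1; rewrite hj /=.
by rewrite leNgt; apply/negP => /jmin; rewrite ltnn.
Qed.

(** Where 2^(-j-1) < 1 - t <= 2^(-j) the integrand is at most 2^((j+1)s), and the interval [1 -
    2^(-j), 1) has mass at most K 2^(-j); the sum is geometric of ratio 2^(s-1) < 1. The layers
    [u j] live on these whole nested intervals: overcounting is harmless in an upper bound. *)
Lemma Carleson_integral_power (s : R) : one_Carleson mu -> 0 <= s < 1 ->
  (\int[mu]_(t in `[0%R, 1%R[) ((1 - t) `^ (- s))%:E < +oo)%E.
Proof.
move=> /one_Carleson_bound [K K0 HK] /andP[s0 s1].
pose I j : set (measurableTypeR R) := [set` `[1 - 2^-1 ^+ j, 1[].
pose u j (t : R) : \bar R := ((2^-1 ^+ j.+1) `^ (- s) * \1_(I j) t)%:E.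
have half0 j : 0 < 2^-1 ^+ j :> R by rewrite exprn_gt0.
have half1 j : 2^-1 ^+ j <= 1 :> R by rewrite exprn_ile1// invf_le1 ?ler1n.
have u0 j t : (0 <= u j t)%E by rewrite lee_fin mulr_ge0 ?powR_ge0.
have mu_u j : measurable_fun ([set` `[0%R, 1%R[] : set R) (u j).
  apply/measurable_EFinP; apply: measurable_funM; first exact: measurable_cst.
  by apply: measurable_indic; exact: measurable_itv.
apply: (@le_lt_trans _ _ (\int[mu]_(t in `[0%R, 1%R[) \sum_(j <oo) u j t)%E).
  apply: ge0_subset_le_integral => // t; last by move=> _; exact: nneseries_ge0.
  rewrite /= in_itv /= => /andP[t0 t1]; rewrite lee_fin powR_ge0 /=.
  have t01 : 0 < 1 - t <= 1 by apply/andP; split; lra.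
  have [j /andP[j1 j2]] := ge0_exists_dyadic t01.
  apply: (@le_trans _ _ (u j t)).
    rewrite /u lee_fin indicE mem_set ?mulr1; last first.
      by rewrite /I /= in_itv /= t1 andbT; lra.
    rewrite !powRN lef_pV2 ?posrE ?powR_gt0//; last by lra.
    by rewrite ge0_ler_powR ?nnegrE ?(ltW (half0 _)) ?(ltW j1)//; lra.
  apply: (@le_trans _ _ (\sum_(0 <= i < j.+1) u i t)%E).
    by rewrite big_nat_recr//= leeDr// sume_ge0.
  by apply: nneseries_lim_ge => *; exact: u0.
rewrite integral_nneseries//.
pose rho : R := 2 `^ (s - 1).
have rho1 : rho < 1.
  rewrite /rho -(opprB 1 s) powRN invf_lt1 ?powR_gt0//.
  have /(_ (1 - s)) e1 : forall x : R, 1 `^ x = 1 by move=> x; rewrite powR1.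
  by rewrite -[ltLHS]e1 gt0_ltr_powR ?nnegrE ?ltr1n// subr_gt0.
have rho0 : 0 < rho by exact: powR_gt0.
apply: (@le_lt_trans _ _ (\sum_(j <oo) (K * 2 `^ s * rho ^+ j)%:E)%E).
  apply: lee_nneseries; first by move=> j _ _; apply: integral_ge0.
  move=> j _; rewrite /u.
  under eq_integral do rewrite EFinM.
  rewrite ge0_integralZl//; last first.
    by apply/measurable_EFinP; apply: measurable_indic; exact: measurable_itv.
  rewrite integral_indic//; last exact: measurable_itv.
  rewrite (@setIidl R (I j)); last first.
    move=> t; rewrite /I /= !in_itv /= => /andP[t1 ->]; rewrite andbT.
    by apply: le_trans t1; rewrite subr_ge0.
  apply: (@le_trans _ _ (((2^-1 ^+ j.+1) `^ (- s))%:E * (K * 2^-1 ^+ j)%:E)%E).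
    rewrite lee_wpmul2l ?lee_fin ?powR_ge0//.
    have := HK (1 - 2^-1 ^+ j).
    have -> : 1 - (1 - 2^-1 ^+ j) = 2^-1 ^+ j :> R by ring.
    apply.
    by rewrite subr_ge0 half1 gtrBl half0.
  rewrite -EFinM lee_fin le_eqVlt; apply/orP; left; apply/eqP.
  have -> : 2^-1 = 2 `^ (-1) :> R by rewrite powR_inv1.
  rewrite /rho -!powR_mulrn ?powR_ge0// -!powRrM mulrCA -!mulrA.
  congr (_ * _); rewrite -!powRD ?pnatr_eq0 ?implybT//.
  by congr (_ `^ _); rewrite -natr1; ring.
have : cvgn (series (geometric (K * 2 `^ s) rho)).
  by apply: is_cvg_geometric_series; rewrite gtr0_norm.
move=> cv; rewrite [ltLHS](_ : _ = (limn (series (geometric (K * 2 `^ s) rho)))%:E) ?ltry//.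
rewrite -EFin_lim//; congr (limn _); apply/funext => n.
by rewrite /= /series /= sumEFin.
Qed.

End Carleson.

(** * The Hilbert operator *)

Section complex_integral.
Variables (R : realType) (mu : {finite_measure set R -> \bar R}).
Local Notation I01 := ([set` `[0%R, 1%R[] : set R).
Implicit Types (g h : R -> R[i]^o) (G : R -> R).

Let mI : measurable I01. Proof. exact: measurable_itv. Qed.

Lemma cintegrable_dominated g G : cmeasurable I01 g ->
  mu.-integrable I01 (EFin \o G) -> (forall t, 0 <= t < 1 -> cmod (g t) <= G t) ->
  cintegrable mu g.
Proof.
move=> [mg1 mg2] iG gG; split.
  apply: (le_integrable mI _ _ iG); first exact/measurable_EFinP.
  move=> t /=; rewrite in_itv /= => t01; rewrite lee_fin.
  by apply: (le_trans (le_Re_cmod _)); apply: (le_trans (gG _ t01)); exact: ler_norm.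
apply: (le_integrable mI _ _ iG); first exact/measurable_EFinP.
move=> t /=; rewrite in_itv /= => t01; rewrite lee_fin.
by apply: (le_trans (le_Im_cmod _)); apply: (le_trans (gG _ t01)); exact: ler_norm.
Qed.

Lemma eq_cintegral g h : (forall t, 0 <= t < 1 -> g t = h t) ->
  cintegral mu g = cintegral mu h.
Proof.
move=> gh; rewrite /cintegral; congr Complex; apply: eq_Rintegral => t;
  by rewrite inE /= in_itv /= => /gh ->.
Qed.

Lemma cintegralD g h : cintegrable mu g -> cintegrable mu h ->
  cintegral mu (fun t => g t + h t) = cintegral mu g + cintegral mu h.
Proof.
move=> [g1 g2] [h1 h2]; rewrite /cintegral; apply/eqP; rewrite eq_complex /=.
apply/andP; split; apply/eqP.
  by rewrite -RintegralD//; apply: eq_Rintegral => t _; rewrite ReD.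
by rewrite -RintegralD//; apply: eq_Rintegral => t _; rewrite ImD.
Qed.

Lemma cintegrableD g h : cintegrable mu g -> cintegrable mu h ->
  cintegrable mu (fun t => g t + h t).
Proof.
move=> [g1 g2] [h1 h2]; split.
  have := integrableD mI g1 h1; congr integrable.
  by apply/funext => t /=; rewrite ReD EFinD.
have := integrableD mI g2 h2; congr integrable.
by apply/funext => t /=; rewrite ImD EFinD.
Qed.

Lemma cintegrableZ (c : R[i]) g : cintegrable mu g ->
  cintegrable mu (fun t => c * g t).
Proof.
move=> [g1 g2]; split.
  have := integrableB mI (integrableZl mI (complex.Re c) g1)
    (integrableZl mI (complex.Im c) g2).
  by congr integrable; apply/funext => t /=; rewrite ReM EFinB !EFinM.
have := integrableD mI (integrableZl mI (complex.Re c) g2)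
  (integrableZl mI (complex.Im c) g1).
by congr integrable; apply/funext => t /=; rewrite ImM EFinD !EFinM.
Qed.

Lemma cintegralZ (c : R[i]) g : cintegrable mu g ->
  cintegral mu (fun t => c * g t) = c * cintegral mu g.
Proof.
move=> [g1 g2]; rewrite /cintegral; apply/eqP; rewrite eq_complex /=.
have Z1 k : mu.-integrable I01 (EFin \o (fun t => k * complex.Re (g t))).
  exact: (integrableZl mI k g1).
have Z2 k : mu.-integrable I01 (EFin \o (fun t => k * complex.Im (g t))).
  exact: (integrableZl mI k g2).
case: c => a b /=; apply/andP; split; apply/eqP.
  rewrite -!RintegralZl// -RintegralB//.
  by apply: eq_Rintegral => t _; rewrite ReM.
rewrite -!RintegralZl// -RintegralD//.
by apply: eq_Rintegral => t _; rewrite ImM.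
Qed.

Lemma cintegral_sum (g : nat -> R -> R[i]^o) (n : nat) :
  (forall k, cintegrable mu (g k)) ->
  cintegral mu (fun t => \sum_(0 <= k < n) g k t) =
  \sum_(0 <= k < n) cintegral mu (g k).
Proof.
(* Integrability of the partial sums is carried along the induction, since additivity requires
   it. *)
move=> ig; suff : cintegrable mu (fun t => \sum_(0 <= k < n) g k t) /\
  cintegral mu (fun t => \sum_(0 <= k < n) g k t) =
  \sum_(0 <= k < n) cintegral mu (g k) by case.
elim: n => [|n [IH1 IH2]].
  have -> : (fun t => \sum_(0 <= k < 0) g k t) = (fun t => 0 * g 0%N t).
    by apply/funext => t; rewrite big_geq// mul0r.
  by split; [exact: cintegrableZ|rewrite cintegralZ// big_geq// mul0r].
have -> : (fun t => \sum_(0 <= k < n.+1) g k t) =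
    (fun t => \sum_(0 <= k < n) g k t + g n t).
  by apply/funext => t; rewrite big_nat_recr.
split; first exact: cintegrableD.
by rewrite cintegralD// IH2 big_nat_recr.
Qed.

(** The factor 2 comes from bounding the real and imaginary parts separately. *)
Lemma cmod_cintegral_le g G : cmeasurable I01 g ->
  mu.-integrable I01 (EFin \o G) -> (forall t, 0 <= t < 1 -> cmod (g t) <= G t) ->
  cmod (cintegral mu g) <= 2 * \int[mu]_(t in I01) G t.
Proof.
move=> mg iG gG; have [g1 g2] := cintegrable_dominated mg iG gG.
apply: (le_trans (cmod_le_ReIm _)); rewrite mulr_natl mulr2n lerD//=.
  apply: (le_trans (le_normr_Rintegral mI g1)); apply: le_Rintegral => //.
    exact: integrable_norm.
  by move=> t /=; rewrite in_itv /= => t01; rewrite (le_trans (le_Re_cmod _))// gG.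
apply: (le_trans (le_normr_Rintegral mI g2)); apply: le_Rintegral => //.
  exact: integrable_norm.
by move=> t /=; rewrite in_itv /= => t01; rewrite (le_trans (le_Im_cmod _))// gG.
Qed.

Lemma Rintegral_dominated (u : nat -> R -> R) (l G : R -> R) :
  (forall n, measurable_fun I01 (u n)) -> mu.-integrable I01 (EFin \o G) ->
  (forall n t, 0 <= t < 1 -> `|u n t| <= G t) ->
  (forall t, 0 <= t < 1 -> (fun n => u n t) @ \oo --> l t) ->
  mu.-integrable I01 (EFin \o l) /\
  (fun n => \int[mu]_(t in I01) u n t) @ \oo --> \int[mu]_(t in I01) l t.
Proof.
move=> mu_ iG uG ul.
have ml : measurable_fun I01 l.
  by apply: (measurable_fun_cvg mu_) => t /=; rewrite in_itv /=; exact: ul.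
have muE n : measurable_fun I01 (EFin \o u n) by exact/measurable_EFinP.
have mlE : measurable_fun I01 (EFin \o l) by exact/measurable_EFinP.
have ae_cvg : \forall t \ae mu, I01 t ->
    (fun n => (EFin \o u n) t) @ \oo --> (EFin \o l) t.
  apply: aeW => t /=; rewrite in_itv /= => t01.
  by apply: cvg_EFin; [exact: nearW|exact: ul].
have ae_le : \forall t \ae mu, forall n, I01 t ->
    (`|(EFin \o u n) t| <= (EFin \o G) t)%E.
  by apply: aeW => t n /=; rewrite in_itv /= => t01; rewrite lee_fin uG.
have [il _ cv] := dominated_convergence mI muE mlE ae_cvg iG ae_le.
split=> //; apply: fine_cvg; rewrite fineK; first exact: cv.
exact: integrable_fin_num.
Qed.

Lemma cintegral_dominated (u : nat -> R -> R[i]^o) g G :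
  (forall n, cmeasurable I01 (u n)) -> mu.-integrable I01 (EFin \o G) ->
  (forall n t, 0 <= t < 1 -> cmod (u n t) <= G t) ->
  (forall t, 0 <= t < 1 -> (fun n => u n t) @ \oo --> g t) ->
  cintegrable mu g /\
  (fun n => cintegral mu (u n)) @ \oo --> cintegral mu g.
Proof.
move=> mu_ iG uG ug.
have [i1 c1] : mu.-integrable I01 (EFin \o (fun t => complex.Re (g t))) /\
    (fun n => \int[mu]_(t in I01) complex.Re (u n t)) @ \oo -->
      \int[mu]_(t in I01) complex.Re (g t).
  apply: (Rintegral_dominated _ iG).
  - by move=> n; case: (mu_ n).
  - by move=> n t t01; rewrite (le_trans (le_Re_cmod _))// uG.
  - by move=> t t01; have [] := ccvg_ReIm (ug t t01).
have [i2 c2] : mu.-integrable I01 (EFin \o (fun t => complex.Im (g t))) /\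
    (fun n => \int[mu]_(t in I01) complex.Im (u n t)) @ \oo -->
      \int[mu]_(t in I01) complex.Im (g t).
  apply: (Rintegral_dominated _ iG).
  - by move=> n; case: (mu_ n).
  - by move=> n t t01; rewrite (le_trans (le_Im_cmod _))// uG.
  - by move=> t t01; have [] := ccvg_ReIm (ug t t01).
by split=> //; exact: ReIm_ccvg.
Qed.

End complex_integral.

Section geometric.
Variable R : realType.
Implicit Type w : R[i].

Lemma cmod_oneB_ge w : 1 - cmod w <= cmod (1 - w).
Proof. by rewrite -{1}(cmod1 R) le_cmodB. Qed.

Lemma oneB_neq0 w : cmod w < 1 -> 1 - w != 0.
Proof. by move=> w1; rewrite -cmod_eq0 gt_eqF// (lt_le_trans _ (cmod_oneB_ge w))// subr_gt0. Qed.

Lemma cmod_oneB_inv_le w (r : R) : cmod w <= r -> r < 1 -> cmod (1 - w)^-1 <= (1 - r)^-1.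
Proof.
move=> wr r1; rewrite cmodV lef_pV2 ?posrE ?subr_gt0//.
  by rewrite (le_trans _ (cmod_oneB_ge w))// lerD2l lerN2.
by rewrite (lt_le_trans _ (cmod_oneB_ge w))// subr_gt0 (le_lt_trans wr).
Qed.

Lemma cmod_geometric_le w (r : R) n : cmod w <= r -> r < 1 ->
  cmod (\sum_(0 <= k < n) w ^+ k) <= (1 - r)^-1.
Proof.
move=> wr r1; have r0 : 0 <= r := le_trans (cmod_ge0 w) wr.
apply: (le_trans (le_cmod_sum _ _ _)).
apply: (@le_trans _ _ (\sum_(0 <= k < n) r ^+ k)).
  by apply: ler_sum => k _; rewrite cmodX lerXn2r ?nnegrE ?cmod_ge0.
rewrite big_mkord -[leRHS]mul1r ler_pdivlMr ?subr_gt0// mulrC.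
by have := subrX1 r n; have := exprn_ge0 n r0; lra.
Qed.

Lemma geometric_cvg w : cmod w < 1 ->
  (fun n => \sum_(0 <= k < n) w ^+ k : R[i]^o) @ \oo --> ((1 - w)^-1 : R[i]^o).
Proof.
move=> w1; apply/ccvgP.
have -> : (fun n => cmod ((\sum_(0 <= k < n) w ^+ k : R[i]^o) - (1 - w)^-1)) =
    (fun n => cmod (1 - w)^-1 * cmod w ^+ n).
  apply/funext => n; rewrite -cmodX -cmodM -cmodN; congr cmod.
  rewrite big_mkord.
  apply: (mulfI (oneB_neq0 w1)); rewrite mulrA divff ?oneB_neq0// mul1r.
  rewrite opprB mulrBr divff ?oneB_neq0//.
  by have := subrX1 w n; rewrite -[in (1 - w) * _]opprB mulNr => <-; ring.
rewrite -[0 in X in _ --> X](mulr0 (cmod (1 - w)^-1)).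
by apply: cvgMr; apply: cvg_expr; rewrite ger0_norm ?cmod_ge0.
Qed.

End geometric.

(** * Termwise integration under the integrable majorant G *)

Section Hilbert_operator.
Variables (R : realType) (f : R[i]^o -> R[i]^o) (a : nat -> R[i]^o).
Variables (mu : {finite_measure set R -> \bar R}) (G : R -> R).
Local Notation I01 := ([set` `[0%R, 1%R[] : set R).
Hypothesis fa : forall z : R[i]^o, unit_disc z ->
  series (fun k => a k * z ^+ k : R[i]^o) @ \oo --> f z.
Hypothesis aG : forall (t : R) (n : nat), 0 <= t < 1 ->
  \sum_(k < n) cmod (a k) * t ^+ k <= G t.
Hypothesis iG : mu.-integrable I01 (EFin \o G).

Let mI : measurable I01. Proof. exact: measurable_itv. Qed.

Lemma cmod_psum_le (t : R) n : 0 <= t < 1 -> cmod (psum a n t%:C) <= G t.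
Proof.
move=> t01; apply: le_trans (aG n t01); apply: (le_trans (le_cmod_sum _ _ _)).
rewrite big_mkord; apply: ler_sum => k _; rewrite cmodM cmodX cmod_real.
by rewrite ger0_norm//; case/andP: t01.
Qed.

Lemma cmod_real_lt1 (t : R) : 0 <= t < 1 -> cmod (t%:C : R[i]) < 1.
Proof. by case/andP => t0 t1; rewrite cmod_real ger0_norm. Qed.

Lemma cmod_f_le (t : R) : 0 <= t < 1 -> cmod (f t%:C) <= G t.
Proof.
move=> t01; apply/ler_addgt0Pl => e e0.
have tt : cmod (t%:C : R[i]) <= t by case/andP: t01 => t0 _; rewrite cmod_real ger0_norm.
have [N HN] := psum_uniform fa t01 e0.
have := HN N t%:C (leqnn _) tt; rewrite cmodB => h.
rewrite -[f _](subrK (psum a N t%:C)).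
by apply: (le_trans (le_cmodD _ _)); rewrite lerD// cmod_psum_le.
Qed.

Lemma cmeasurable_id : cmeasurable I01 (fun t : R => t%:C : R[i]).
Proof. by apply: cmeasurable_real; exact: measurable_id. Qed.

Lemma cmeasurable_f : cmeasurable I01 (fun t : R => f t%:C).
Proof.
apply: (cmeasurable_pseries fa); first exact: cmeasurable_id.
by move=> t /=; rewrite in_itv /=; exact: cmod_real_lt1.
Qed.

Lemma cmod_realX_le (t : R) n : 0 <= t < 1 -> cmod (t%:C ^+ n : R[i]) <= 1.
Proof.
by case/andP => t0 t1; rewrite cmodX cmod_real ger0_norm// exprn_ile1// ltW.
Qed.

Lemma cintegrable_monomial n : cintegrable mu (fun t => t%:C ^+ n).
Proof.
apply: (@cintegrable_dominated _ _ _ (cst 1)).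
- exact/cmeasurableX/cmeasurable_id.
- exact: finite_measure_integrable_cst.
- by move=> t; exact: cmod_realX_le.
Qed.

Lemma cintegral_monomial n : cintegral mu (fun t => t%:C ^+ n) = (moment mu n)%:C.
Proof.
have XE t : (t%:C ^+ n : R[i]) = (t ^+ n)%:C by rewrite rmorphXn.
rewrite /cintegral /moment; apply/eqP; rewrite eq_complex /=; apply/andP; split.
  by apply/eqP/eq_Rintegral => t _; rewrite XE.
rewrite (@eq_Rintegral _ _ _ _ _ (cst 0)) ?Rintegral_cst ?mul0r//.
by move=> t _; rewrite XE.
Qed.

Lemma moment_EFin n : (moment mu n)%:E = (\int[mu]_(t in I01) (t ^+ n)%:E)%E.
Proof.
rewrite /moment /Rintegral fineK//; apply: integrable_fin_num => //.
have [i1 _] := cintegrable_monomial n; move: i1; congr integrable.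
by apply/funext => t; rewrite -rmorphXn.
Qed.

(** By Tonelli the sum is the integral of the series of |a_k| t^(n+k), and t^n <= 1 leaves G as a
    majorant. *)
Lemma moment_series_finite n :
  (\sum_(0 <= k <oo) (moment mu (n + k) * cmod (a k))%:E < +oo)%E.
Proof.
have E k : (moment mu (n + k) * cmod (a k))%:E =
    (\int[mu]_(t in I01) ((cmod (a k))%:E * (t ^+ (n + k))%:E))%E.
  rewrite ge0_integralZl//.
  - by rewrite -moment_EFin -EFinM mulrC.
  - by apply/measurable_EFinP; apply: measurable_funX; exact: measurable_id.
  - by move=> t /=; rewrite in_itv /= => /andP[t0 _]; rewrite lee_fin exprn_ge0.
  - by rewrite lee_fin cmod_ge0.
have T0 k t : I01 t -> (0 <= (cmod (a k))%:E * (t ^+ (n + k))%:E)%E.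
  rewrite /= in_itv /= => /andP[t0 _].
  by rewrite -EFinM lee_fin mulr_ge0 ?cmod_ge0 ?exprn_ge0.
under eq_eseriesr do rewrite E.
rewrite -integral_nneseries//; last first.
  move=> k; apply: emeasurable_funM; first exact: measurable_cst.
  by apply/measurable_EFinP; apply: measurable_funX; exact: measurable_id.
apply: le_lt_trans (integrable_lty mI iG); apply: ge0_subset_le_integral => //.
  move=> t It; apply/andP; split; first by apply: nneseries_ge0 => k _ _; exact: T0.
  apply: lime_le; first by apply: is_cvg_nneseries => k _ _; exact: T0.
  move: It; rewrite /= in_itv /= => t01; have /andP[t0 t1] := t01.
  apply: nearW => N; under eq_bigr do rewrite -EFinM.
  rewrite sumEFin lee_fin big_mkord; apply: le_trans (aG N t01).
  apply: ler_sum => k _; rewrite ler_wpM2l ?cmod_ge0// exprD.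
  by rewrite ler_piMl ?exprn_ge0// exprn_ile1// ltW.
move=> t /=; rewrite in_itv /= => t01; rewrite lee_fin.
(* The empty sum shows G t >= 0. *)
by have := aG 0%N t01; rewrite big_ord0.
Qed.

(** The partial sums are the integrals of t^n times the partial sums of f, all dominated by G. The
    limit, a moment of f, is what lets the sum over n become the kernel 1 / (1 - t z). *)
Lemma Hmu_coef_series_cvg n :
  Hmu_coef_series mu a n @ \oo --> cintegral mu (fun t => t%:C ^+ n * f t%:C).
Proof.
have -> : Hmu_coef_series mu a n =
    (fun N => cintegral mu (fun t => t%:C ^+ n * psum a N t%:C)).
  apply/funext => N.
  transitivity (cintegral mu (fun t => \sum_(0 <= k < N) a k * t%:C ^+ (n + k))).
    rewrite cintegral_sum => [|k]; last exact/cintegrableZ/cintegrable_monomial.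
    apply: eq_bigr => k _; rewrite cintegralZ; last exact: cintegrable_monomial.
    by rewrite cintegral_monomial mulrC.
  apply: eq_cintegral => t _; rewrite /psum mulr_sumr; apply: eq_bigr => k _.
  by rewrite exprD mulrCA.
have [] // := @cintegral_dominated _ mu
  (fun N t => t%:C ^+ n * psum a N t%:C) (fun t => t%:C ^+ n * f t%:C) G.
- move=> N; apply: cmeasurableM; first exact/cmeasurableX/cmeasurable_id.
  apply: cmeasurable_sum => k; apply: cmeasurableM; first exact: cmeasurable_cst.
  exact/cmeasurableX/cmeasurable_id.
- move=> N t t01; rewrite cmodM -[leRHS]mul1r.
  by rewrite ler_pM ?cmod_ge0 ?cmod_realX_le ?cmod_psum_le.
- move=> t t01; apply: cvgMr; apply: (psum_cvg fa); exact: cmod_real_lt1.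
Qed.

Lemma Hmu_coefE n : Hmu_coef mu a n = cintegral mu (fun t => t%:C ^+ n * f t%:C).
Proof. by apply/cvg_lim => //; exact: Hmu_coef_series_cvg. Qed.

Lemma integrable_GZ (c : R) : mu.-integrable I01 (EFin \o (fun t => c * G t)).
Proof. exact: (integrableZl mI c iG). Qed.

Lemma cmod_realM_le (t : R) (z : R[i]) : 0 <= t < 1 -> cmod (t%:C * z) <= cmod z.
Proof.
by case/andP => t0 t1; rewrite cmodM cmod_real ger0_norm// ler_piMl ?cmod_ge0 ?ltW.
Qed.

(** Partial sums in n put a truncated geometric series in t z under the integral; its modulus is at
    most 1 / (1 - |z|), so G / (1 - |z|) dominates. *)
Lemma Hmu_series_cvg (z : R[i]^o) : cmod z < 1 ->
  cintegrable mu (Imu_integrand f z) /\ Hmu_series mu a z @ \oo --> Imu mu f z.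
Proof.
move=> z1.
have -> : Hmu_series mu a z = (fun N => cintegral mu
    (fun t => f t%:C * \sum_(0 <= n < N) (t%:C * z) ^+ n)).
  apply/funext => N.
  transitivity (cintegral mu
      (fun t => \sum_(0 <= n < N) z ^+ n * (t%:C ^+ n * f t%:C))).
    have i_n n : cintegrable mu (fun t => t%:C ^+ n * f t%:C).
      apply: (@cintegrable_dominated _ _ _ G) => //.
        by apply: cmeasurableM; [exact/cmeasurableX/cmeasurable_id|exact: cmeasurable_f].
      move=> t t01; rewrite cmodM -[leRHS]mul1r.
      by rewrite ler_pM ?cmod_ge0 ?cmod_realX_le ?cmod_f_le.
    rewrite cintegral_sum => [|n]; last exact: cintegrableZ.
    by apply: eq_bigr => n _; rewrite cintegralZ// Hmu_coefE mulrC.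
  apply: eq_cintegral => t _; rewrite mulr_sumr; apply: eq_bigr => n _.
  by rewrite exprMn; ring.
apply: (@cintegral_dominated _ mu _ _ (fun t => (1 - cmod z)^-1 * G t)).
- move=> N; apply: cmeasurableM; first exact: cmeasurable_f.
  apply: cmeasurable_sum => k; apply: cmeasurableX; apply: cmeasurableM.
    exact: cmeasurable_id.
  exact: cmeasurable_cst.
- exact: integrable_GZ.
- move=> N t t01; rewrite cmodM mulrC ler_pM ?cmod_ge0 ?cmod_f_le//.
  by apply: cmod_geometric_le => //; exact: cmod_realM_le.
- move=> t t01; apply: cvgMr; apply: geometric_cvg.
  exact: le_lt_trans (cmod_realM_le z t01) z1.
Qed.

Lemma HmuE (z : R[i]^o) : cmod z < 1 -> Hmu mu a z = Imu mu f z.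
Proof. by move=> z1; apply/cvg_lim => //; have [] := Hmu_series_cvg z1. Qed.

Lemma cmeasurable_oneB_inv (z : R[i]) : cmod z < 1 ->
  cmeasurable I01 (fun t : R => (1 - t%:C * z)^-1).
Proof.
move=> z1; apply: (@cmeasurable_lim _ _ R I01
    (fun n t => \sum_(0 <= k < n) (t%:C * z) ^+ k : R[i]^o)
    (fun t => (1 - t%:C * z)^-1 : R[i]^o)).
  move=> n; apply: cmeasurable_sum => k; apply: cmeasurableX; apply: cmeasurableM.
    exact: cmeasurable_id.
  exact: cmeasurable_cst.
move=> t /=; rewrite in_itv /= => t01; apply: geometric_cvg.
exact: le_lt_trans (cmod_realM_le z t01) z1.
Qed.

(* The integrand of [Imu] satisfies a first-order Taylor estimate with a remainder
   [O(h ^ 2)] which is uniform in [t] up to the integrable weight [G]. *)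
Lemma Imu_quotient_bound (z : R[i]) : cmod z < 1 -> exists (L : R[i]) (K : R),
  forall h : R[i], h != 0 -> cmod h <= (1 - cmod z) / 2 ->
  cmod (h^-1 * (Imu mu f (h + z) - Imu mu f z) - L) <= K * cmod h.
Proof.
(* The midpoint of |z| and 1: the restriction on h keeps z and h + z in the disc of radius r, so all
   inverses are bounded by d. *)
move=> z1; set r := (1 + cmod z) / 2; have z0 := cmod_ge0 z.
have r1 : r < 1 by rewrite /r; lra.
have zr : cmod z <= r by rewrite /r; lra.
pose d := (1 - r)^-1; have d0 : 0 <= d by rewrite invr_ge0; lra.
(* The z-derivative of the integrand. *)
pose l t : R[i]^o := f t%:C * (t%:C * (1 - t%:C * z)^-1 * (1 - t%:C * z)^-1).
have ml : cmeasurable I01 l.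
  apply: cmeasurableM; first exact: cmeasurable_f.
  apply: cmeasurableM; last exact: cmeasurable_oneB_inv.
  by apply: cmeasurableM; [exact: cmeasurable_id|exact: cmeasurable_oneB_inv].
have tr t w : 0 <= t < 1 -> cmod w <= r -> cmod (1 - t%:C * w)^-1 <= d.
  by move=> t01 wr; apply: cmod_oneB_inv_le => //; exact: le_trans (cmod_realM_le w t01) wr.
have t1 t : 0 <= t < 1 -> cmod (t%:C : R[i]) <= 1 by move=> t01; exact/ltW/cmod_real_lt1.
have il : cintegrable mu l.
  apply: (@cintegrable_dominated _ _ _ (fun t => (1 * d * d) * G t)) => //.
    exact: integrable_GZ.
  move=> t t01; rewrite !cmodM mulrC.
  by rewrite !ler_pM ?mulr_ge0 ?cmod_ge0 ?t1 ?tr ?cmod_f_le.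
exists (cintegral mu l), (2 * \int[mu]_(t in I01) (1 * d * d * d * G t)) => h h0 hr.
have hzr : cmod (h + z) <= r.
  by apply: (le_trans (le_cmodD _ _)); move: hr; rewrite /r; lra.
have hz1 : cmod (h + z) < 1 := le_lt_trans hzr r1.
have [ihz _] := Hmu_series_cvg hz1; have [iz _] := Hmu_series_cvg z1.
(* The exact remainder divided by h^2: with u = 1 - t z, 1 / (u - t h) = 1/u + t h / u^2 + t^2 h^2 /
   (u^2 (u - t h)). *)
pose e t : R[i]^o := f t%:C *
  (t%:C ^+ 2 * (1 - t%:C * (h + z))^-1 * (1 - t%:C * z)^-1 * (1 - t%:C * z)^-1).
have eG t : 0 <= t < 1 -> cmod (e t) <= 1 * d * d * d * G t.
  move=> t01; rewrite !cmodM mulrC.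
  by rewrite !ler_pM ?mulr_ge0 ?cmod_ge0 ?mulr_ile1 ?cmod_ge0 ?t1 ?tr ?cmod_f_le.
have me : cmeasurable I01 e.
  apply: cmeasurableM; first exact: cmeasurable_f.
  apply: cmeasurableM; last exact: cmeasurable_oneB_inv.
  apply: cmeasurableM; last exact: cmeasurable_oneB_inv.
  apply: cmeasurableM; last exact: cmeasurable_oneB_inv.
  exact/cmeasurableX/cmeasurable_id.
have ie : cintegrable mu e.
  exact: (cintegrable_dominated me (integrable_GZ _) eG).
have -> : h^-1 * (Imu mu f (h + z) - Imu mu f z) - cintegral mu l =
    h * cintegral mu e.
  have -> : Imu mu f (h + z) = Imu mu f z + h * cintegral mu l + h ^+ 2 * cintegral mu e.
    have ilh := cintegrableZ h il; have ieh := cintegrableZ (h ^+ 2) ie.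
    rewrite /Imu -(cintegralZ h il) -(cintegralZ (h ^+ 2) ie).
    rewrite -(cintegralD iz ilh) -(cintegralD (cintegrableD iz ilh) ieh).
    apply: eq_cintegral => t t01; rewrite /Imu_integrand /l /e.
    have n1 : 1 - t%:C * z != 0.
      by apply: oneB_neq0; exact: le_lt_trans (cmod_realM_le z t01) z1.
    have n2 : 1 - t%:C * (h + z) != 0.
      by apply: oneB_neq0; exact: le_lt_trans (cmod_realM_le _ t01) hz1.
    by field; rewrite n1 n2.
  by field.
rewrite cmodM mulrC ler_wpM2r ?cmod_ge0//.
apply: cmod_cintegral_le => //; first exact: integrable_GZ.
Qed.

Lemma Hmu_derivable (z : R[i]^o) : cmod z < 1 ->
  derivable (Hmu mu a : R[i]^o -> R[i]^o) z 1.
Proof.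
move=> z1; have [L [K HK]] := Imu_quotient_bound z1.
apply/cvg_ex; exists (L : R[i]^o); apply/ccvgP.
have h_cvg0 : (fun h : R[i]^o => cmod h) @ (0 : R[i]^o)^' --> (0 : R).
  have /ccvgP : (id : R[i]^o -> R[i]^o) @ (0 : R[i]^o)^' --> (0 : R[i]^o).
    exact: nbhs_dnbhs.
  by under eq_fun do rewrite subr0.
have d0 : 0 < (1 - cmod z) / 2 by rewrite divr_gt0// subr_gt0.
apply: (@squeeze_cvgr _ _ _ _ (cst 0) (fun h : R[i]^o => K * cmod h)).
- have near_small : \forall h \near (0 : R[i]^o)^', cmod h <= (1 - cmod z) / 2.
    move/cvgrPdist_le : h_cvg0 => /(_ _ d0); apply: filterS => h.
    by rewrite sub0r normrN ger0_norm ?cmod_ge0.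
  near=> h.
  have h0 : h != 0 by near: h; exact: nbhs_dnbhs_neq.
  have hs : cmod h <= (1 - cmod z) / 2 by near: h.
  rewrite cmod_ge0 /=.
  (* [Hmu] and [Imu] are identified only inside the disc, so h must be small enough for h + z to
     stay there. *)
  have hz1 : cmod (h + z) < 1 by apply: (le_lt_trans (le_cmodD _ _)); lra.
  have := HK h h0 hs.
  by rewrite /GRing.scale /= mulr1 !HmuE.
- exact: cvg_cst.
- rewrite -[0 in X in _ --> X](mulr0 K).
  exact: cvgMr.
Unshelve. all: by end_near.
Qed.

End Hilbert_operator.

Theorem proposition1p3 (R : realType) (p q : R)
    (f : R[i]^o -> R[i]^o) (a : nat -> R[i]^o)
    (mu : {finite_measure set R -> \bar R}) :
  1 < p -> 1 < q -> p^-1 + q^-1 < 1 -> 2 < p ->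
  AT_space p q f ->
  (forall z : R[i]^o, unit_disc z ->
     series (fun k => a k * z ^+ k : R[i]^o) @ \oo --> f z) ->
  one_Carleson mu ->
  [/\ forall n : nat,
        (\sum_(0 <= k <oo) (moment mu (n + k) * cmod (a k))%:E < +oo)%E,
      (forall n : nat, cvgn (Hmu_coef_series mu a n)) /\
      (forall z : R[i]^o, unit_disc z -> cvgn (Hmu_series mu a z)) /\
      analytic_on_disc (Hmu mu a)
    & forall z : R[i]^o, unit_disc z ->
        cintegrable mu (Imu_integrand f z) /\ Hmu mu a z = Imu mu f z].
Proof.
move=> p1 q1 pq p2 [_ fAT] fa mu1.
have [g [C [g01 C0 hC]]] := circle_square_bound fa p2 q1 pq fAT.
have C2 : 0 < C + 2 by rewrite addr_gt0.
have aG := coef_sum_bound g01 C2 (coef_square_bound fa g01 C0 hC).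
have s01 : 0 <= (1 + g) / 2 < 1 by case/andP: g01 => *; apply/andP; split; lra.
have iG0 : mu.-integrable [set` `[0%R, 1%R[]
    (EFin \o (fun t : R => (1 - t) `^ (- ((1 + g) / 2)))).
  apply/integrableP; split.
    apply/measurable_EFinP; apply: (measurableT_comp (measurable_powR _)).
    by apply: measurable_funB; [exact: measurable_cst|exact: measurable_id].
  under eq_integral => t _ do rewrite /= ger0_norm ?powR_ge0//.
  exact: Carleson_integral_power.
(* In the constant, 2 comes from the error in [discrete_Bessel], 1 from the geometric sum in
   [coef_sum_bound], and the power of 2 from passing from the square root of t to t. *)
have iG := integrableZl (measurable_itv `[0%R, 1%R[)
  ((C + 2 + 1) * 2 `^ ((1 + g) / 2)) iG0.
have Hcoef n := Hmu_coef_series_cvg fa aG iG (n := n).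
have Hser (z : R[i]^o) := Hmu_series_cvg fa aG iG (z := z).
split.
- exact: (moment_series_finite aG iG).
- split; first by move=> n; apply/cvgP; exact: Hcoef.
  split; first by move=> z /Hser [_ /cvgP].
  by move=> z; exact: (Hmu_derivable fa aG iG).
- by move=> z z1; split; [have [] := Hser z z1|exact: (HmuE fa aG iG z1)].
Qed.
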